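(* Let $G$ be a group having a nilpotent normal subgroup of finite index. If $G$ has no proper contranormal subgroups, then $G$ is nilpotent.
   Context: A subgroup $H$ of a group $G$ is called contranormal in $G$ if $H^G = G$, where $H^G=\langle x^{-1}hx \mid h\in H, x\in G\rangle$ is the normal closure of $H$ in $G$. A proper contranormal subgroup is a contranormal subgroup $H\neq G$. *)

(* Defs.v *)
From Stdlib Require Import List.

Record group := Group {
  carrier :> Type;
  mul : carrier -> carrier -> carrier;
  inv : carrier -> carrier;
  one : carrier;
  mulA : forall x y z, mul x (mul y z) = mul (mul x y) z;
  mul1g : forall x, mul one x = x;
  mulg1 : forall x, mul x one = x;
  mulVg : forall x, mul (inv x) x = one;
  mulgV : forall x, mul x (inv x) = one
}.

Section GroupDefs.
Variable G : group.

Definition subgroup (H : G -> Prop) : Prop :=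
  H (one G) /\ (forall x y, H x -> H y -> H (mul G x y)) /\
  (forall x, H x -> H (inv G x)).

Definition gen (S : G -> Prop) : G -> Prop :=
  fun x => forall H, subgroup H -> (forall y, S y -> H y) -> H x.

Definition conjg (h x : G) : G := mul G (inv G x) (mul G h x).

Definition commg (a b : G) : G :=
  mul G (inv G a) (mul G (inv G b) (mul G a b)).

Definition normal (N : G -> Prop) : Prop :=
  subgroup N /\ forall n x, N n -> N (conjg n x).

Definition normal_closure (H : G -> Prop) : G -> Prop :=
  gen (fun y => exists h x, H h /\ y = conjg h x).

Definition contranormal (H : G -> Prop) : Prop :=
  forall g : G, normal_closure H g.

Definition proper (H : G -> Prop) : Prop := exists g : G, ~ H g.

Definition finite_index (N : G -> Prop) : Prop :=
  exists l : list G, forall g : G, exists a, In a l /\ N (mul G (inv G a) g).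

(* lower central series of a subgroup N:
   gamma_1 = N, gamma_{i+1} = [gamma_i, N] *)
Fixpoint lcs (N : G -> Prop) (n : nat) : G -> Prop :=
  match n with
  | O => N
  | S k => gen (fun y => exists a b, lcs N k a /\ N b /\ y = commg a b)
  end.

Definition nilpotent (N : G -> Prop) : Prop :=
  exists c, forall x, lcs N c x -> x = one G.

Definition nilpotent_group : Prop := nilpotent (fun _ => True).

End GroupDefs.

(* Main.v *)
From Pilot Require Import Defs.
From Stdlib Require Import List.
From HB Require Import structures.
From mathcomp Require Import all_boot all_order all_algebra all_fingroup all_solvable.
From mathcomp Require Import boolp.
From mathcomp Require classical_sets.

(** Finite quotients of [G] are nilpotent because all their maximal subgroups
    are normal (Frattini argument).  By a criterion of P. Hall it then suffices
    that [G / N'] is nilpotent, i.e. that the augmentation ideal [I] of the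
    finite nilpotent group [Q = G / N] acts nilpotently on [M = N / N'].

    If [M / B] is a torsion quotient with [I (M / B) = M / B], then a finitely
    generated supplement of [N], enlarged by [B], is contranormal, hence equal
    to [G]; so [G / B] is finite, thus nilpotent, and [M = B].  Therefore [M]
    has no nonzero torsion quotient on which [I] acts perfectly.

    Let [z] be central in [Q], of prime order [p], and put [t = z - 1].  On
    [M / ker t] the norm of [z] vanishes, so [p]-divisible torsion quotients
    of [M / ker t] are perfect, hence zero.  A group with finitely many
    operators and no such quotient has bounded [p]-power exponent: otherwise
    it has a quasicyclic quotient or a nonzero [q]-torsion one with [q <> p],
    and the intersection of the conjugates of the kernel leads to a forbidden
    quotient.  Since [t ^ p] is divisible by [p], this makes [t] nilpotent on
    [M], and one concludes by induction along a central series of [Q]. *)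

Set Implicit Arguments.
Unset Strict Implicit.
Unset Printing Implicit Defensive.

Import GRing.Theory.

Local Open Scope ring_scope.

(** * Abelian groups with finitely many operators *)

Section ZSubgroups.
Variable M : zmodType.
Implicit Types (B W : M -> Prop) (x y : M).

Lemma subrBB (a b c d : M) : a - b - (c - d) = a - c - (b - d).
Proof. by rewrite !opprB addrACA [- b + _]addrC addrACA. Qed.

Definition zsubgroup B := B 0 /\ forall x y, B x -> B y -> B (x - y).

Section Closure.
Variables (B : M -> Prop) (sB : zsubgroup B).

Lemma zsub0 : B 0. Proof. by case: sB. Qed.
Lemma zsubB x y : B x -> B y -> B (x - y). Proof. by case: sB => _; apply. Qed.
Lemma zsubN x : B x -> B (- x).
Proof. by move=> Bx; rewrite -sub0r; apply: zsubB => //; apply: zsub0. Qed.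
Lemma zsubD x y : B x -> B y -> B (x + y).
Proof. by move=> Bx By; rewrite -[y]opprK; apply/zsubB/zsubN. Qed.
Lemma zsubMn x n : B x -> B (x *+ n).
Proof.
by move=> Bx; elim: n => [|n IH]; rewrite ?mulrS ?mulr0n;
  [apply: zsub0 | apply: zsubD].
Qed.
Lemma zsubMz x k : B x -> B (x *~ k).
Proof. by case: k => n Bx; [|apply: zsubN]; apply: zsubMn. Qed.
Lemma zsub_absz x k : B (x *~ k) <-> B (x *+ `|k|).
Proof.
case: k => n; first by [].
by rewrite NegzE abszN absz_nat mulrNz; split=> /zsubN; rewrite ?opprK.
Qed.
Lemma zsub_dvd x m n : (m %| n)%N -> B (x *+ m) -> B (x *+ n).
Proof. by case/dvdnP=> k ->; rewrite mulnC mulrnA; apply: zsubMn. Qed.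

Lemma zsubC x y : B (x - y) -> B (y - x).
Proof. by move/zsubN; rewrite opprB. Qed.
Lemma zsub_trans y x z : B (x - y) -> B (y - z) -> B (x - z).
Proof. by move=> /zsubD h /h; rewrite addrA subrK. Qed.
Lemma zsub_mem y x : B (x - y) -> B y -> B x.
Proof. by move=> /zsubD h /h; rewrite subrK. Qed.
Lemma zsub_memr y x : B (x - y) -> B x -> B y.
Proof. by move/zsubC; apply: zsub_mem. Qed.
Lemma zsub_congMn x y n : B (x - y) -> B (x *+ n - y *+ n).
Proof. by move=> h; rewrite -mulrnBl; apply: zsubMn. Qed.
Lemma zsub_congMz x y k : B (x - y) -> B (x *~ k - y *~ k).
Proof. by move=> h; rewrite -mulrzBl; apply: zsubMz. Qed.
Lemma zsub_congD x x' y y' :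
  B (x - x') -> B (y - y') -> B (x + y - (x' + y')).
Proof. by move=> hx hy; rewrite opprD addrACA; apply: zsubD. Qed.

Lemma zsub_congB x x' y y' :
  B (x - x') -> B (y - y') -> B (x - y - (x' - y')).
Proof. by move=> hx hy; rewrite subrBB; apply: zsubB. Qed.

Lemma zsub_gcd x m n : B (x *+ m) -> B (x *+ n) -> B (x *+ gcdn m n).
Proof.
have [-> | m0] := posnP m; first by rewrite gcd0n.
move=> Bm Bn; have [u v e _] := egcdnP n m0.
apply: (zsub_mem (y := - (x *+ (v * n)))).
  by rewrite opprK -mulrnDr addnC -e mulnC mulrnA; apply: zsubMn.
by rewrite mulnC mulrnA; apply/zsubN/zsubMn.
Qed.

Lemma zsub_coprime x m n : coprime m n -> B (x *+ m) -> B (x *+ n) -> B x.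
Proof. by move=> /eqP e hm hn; have := zsub_gcd hm hn; rewrite e. Qed.

End Closure.

Definition zadjoin B x : M -> Prop := fun u => exists k : int, B (u - x *~ k).

Lemma zsubgroup_adjoin B x : zsubgroup B -> zsubgroup (zadjoin B x).
Proof.
move=> sB; split=> [|u v [k hk] [l hl]].
  by exists 0; rewrite mulr0z subrr; apply: zsub0.
exists (k - l); by rewrite mulrzBr subrBB; apply: zsubB.
Qed.

Lemma zadjoin_sub B x u : B u -> zadjoin B x u.
Proof. by move=> Bu; exists 0; rewrite mulr0z subr0. Qed.

Lemma zadjoin_gen B x : zsubgroup B -> zadjoin B x x.
Proof. by move=> sB; exists 1; rewrite mulr1z subrr; apply: zsub0. Qed.

Definition maximal_avoiding y W :=
  [/\ zsubgroup W, ~ W y & forall W', zsubgroup W' -> (forall x, W x -> W' x) ->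
                           ~ W' y -> forall x, W' x -> W x].

Lemma exists_maximal_avoiding B y : zsubgroup B -> ~ B y ->
  exists W, maximal_avoiding y W /\ forall x, B x -> W x.
Proof.
move=> sB nBy.
pose good A := [/\ zsubgroup A, forall x, B x -> A x & ~ A y].
have [F FP tF|A [[-> | [sA BA nAy]] maxA]] :=
    @classical_sets.Zorn_bigcup M (fun A => A = @classical_sets.set0 M \/ good A).
- have [[A FA [sA BA nAy]] | none] := pselect (exists2 A, F A & good A); last first.
    left; apply/classical_sets.seteqP; split=> // x [A FA Ax].
    case: (FP _ FA) => [eA|gA]; first by rewrite eA in Ax.
    by case: none; exists A.
  right; split=> [|x Bx|[C FC Cy]]; last first.
  + by case: (FP _ FC) => [eC|[_ _]]; [rewrite eC in Cy | apply].
  + by exists A => //; apply: BA.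
  split=> [|u v [C FC Cu] [C' FC' Cv]]; first by exists A => //; apply: zsub0.
  have [X FX [Xu Xv]] : exists2 X, F X & X u /\ X v.
    by case: (tF _ _ FC FC') => s; [exists C' | exists C] => //; split=> //; apply: s.
  exists X => //; case: (FP _ FX) => [eX|[sX _ _]]; first by rewrite eX in Xu.
  by apply: zsubB.
- exfalso; apply: (maxA B); last by right; split.
  by split=> // h; have := h _ (zsub0 sB).
- exists A; split=> //; split=> // W' sW' AW' nW'y x W'x.
  apply: contrapT => nAx; apply: (maxA W').
    by split=> // h; apply/nAx/h.
  by right; split=> // u /BA /AW'.
Qed.

Section Avoiding.
Variables (y : M) (W : M -> Prop) (maxW : maximal_avoiding y W).
Let sW : zsubgroup W. Proof. by case: maxW. Qed.
Let nWy : ~ W y. Proof. by case: maxW. Qed.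

(** By maximality [W] and [x] together generate [y]: every nonzero subgroup of [M / W] contains the
    image of [y]. *)
Lemma avoiding_multiple x : ~ W x -> exists k : int, W (y - x *~ k).
Proof.
move=> nWx; apply: contrapT => none; apply: nWx; case: maxW => _ _ maxi.
apply: (maxi (zadjoin W x)); [exact: zsubgroup_adjoin|exact: zadjoin_sub| |].
  by case=> k hk; apply: none; exists k.
exact: zadjoin_gen.
Qed.

Variables (r : nat) (pr_r : prime r) (Wry : W (y *+ r)).

(** Some multiple of [x] equals [y] modulo [W], so [x] has finite order there. If its [r]-free part
    were nonzero, [y] would be a multiple of it and have order prime to [r]. *)
Lemma avoiding_torsion x : exists k, W (x *+ r ^ k).
Proof.
have [Wx|/avoiding_multiple[k hk]] := pselect (W x); first by exists 0%N.
have k0 : k != 0 by apply/eqP => k0; move: hk; rewrite k0 mulr0z subr0.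
pose n := (`|k| * r)%N.
have n0 : (0 < n)%N by rewrite muln_gt0 absz_gt0 k0 prime_gt0.
have Wn : W (x *+ n).
  rewrite mulrnA mulrnAC; apply/(zsub_absz sW).
  rewrite pmulrn mulrzAC -pmulrn.
  exact: (zsub_memr sW (zsub_congMn sW r hk)).
have [m co_m def_n] := pfactor_coprime pr_r n0.
exists (logn r n); apply: contrapT => nW'.
have [l hl] := avoiding_multiple nW'.
apply: nWy; apply: (zsub_coprime sW co_m) => //.
apply: (zsub_mem sW (zsub_congMn sW _ hl)).
rewrite pmulrn mulrzAC -pmulrn -mulrnA mulnC -def_n; exact: zsubMz.
Qed.

End Avoiding.
End ZSubgroups.

(** * Invariant subgroups under a group acting through finitely many operators *)

Section FiniteAction.
Variables (M : zmodType) (G : groupType) (act : G -> {additive M -> M}).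
Hypothesis act1 : forall x, act 1%g x = x.
Hypothesis actM : forall g h x, act (g * h)%g x = act h (act g x).
Hypothesis act_finite : exists l : seq G, forall g, exists2 h, h \in l & act g =1 act h.

Definition invariant (B : M -> Prop) := forall g x, B x -> B (act g x).
Definition opcore (W : M -> Prop) : M -> Prop := fun x => forall g, W (act g x).

Lemma zsubgroup_opcore W : zsubgroup W -> zsubgroup (opcore W).
Proof.
move=> sW; split=> [|x y hx hy] g; rewrite ?raddf0 ?raddfB; first exact: zsub0.
exact: zsubB.
Qed.

Lemma invariant_opcore W : invariant (opcore W).
Proof. by move=> g x hx h; rewrite -actM. Qed.

Lemma opcore_max (E W : M -> Prop) : invariant E ->
  (forall x, E x -> W x) -> forall x, E x -> opcore W x.
Proof. by move=> iE EW x Ex g; apply/EW/iE. Qed.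

Lemma opcore_sub W x : opcore W x -> W x.
Proof. by move/(_ 1%g); rewrite act1. Qed.

(** Only finitely many operators occur, so the exponents needed for the images of [x] can be added
    up. *)
Lemma opcore_torsion W r : zsubgroup W ->
  (forall x, exists k, W (x *+ r ^ k)) -> forall x, exists k, opcore W (x *+ r ^ k).
Proof.
move=> sW tW x; have [l hl] := act_finite.
suff [k hk] : exists k, forall g, g \in l -> W (act g x *+ r ^ k).
  by exists k => g; have [h lh ->] := hl g; rewrite raddfMn; apply: hk.
elim: l {hl} => [|g l [k hk]]; first by exists 0%N.
have [j hj] := tW (act g x); exists (k + j)%N => h.
rewrite inE => /predU1P[->|/hk hh];
  last exact: zsub_dvd (dvdn_exp2l _ (leq_addr _ _)) hh.
exact: zsub_dvd (dvdn_exp2l _ (leq_addl _ _)) hj.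
Qed.

(** * Bounded exponent from the absence of divisible torsion quotients *)

Section PrimaryCore.
Variables (p : nat) (E : M -> Prop).
Hypotheses (pr_p : prime p) (sE : zsubgroup E) (iE : invariant E).
Hypothesis no_quotient : forall B : M -> Prop, zsubgroup B -> invariant B ->
  (forall x, E x -> B x) -> (forall x, exists2 n, (0 < n)%N & B (x *+ n)) ->
  (forall x, exists y, B (x - y *+ p)) -> forall x, B x.

(** Otherwise [x] lies outside [E] plus the multiples of [q x]. A subgroup maximal without [x] above
    that has a core with [q]-torsion quotient, which is [p]-divisible since [q <> p], so
    [no_quotient] makes it zero. *)
Lemma torsion_prime_to q x : prime q -> q != p -> exists2 m, coprime m q & E (x *+ m).
Proof.
move=> pr_q neq; apply: contrapT => none.
have sB := zsubgroup_adjoin (x *+ q) sE.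
have nBx : ~ zadjoin E (x *+ q) x.
  case=> k; rewrite -{1}[x]mulr1z pmulrn -mulrzA -mulrzBr => /(zsub_absz sE) hk.
  apply: none; exists `|(1 - q%:Z * k)%R|%N => //.
  rewrite coprime_sym prime_coprime //; apply/negP => h.
  have : (q %| 1 - q%:Z * k)%Z by [].
  rewrite rpredBr ?dvdz_mulr // dvdz1 absz_nat => /eqP q1.
  by rewrite q1 in pr_q.
have [W [maxW BW]] := exists_maximal_avoiding sB nBx.
have sW : zsubgroup W by case: maxW.
have EW u : E u -> W u by move=> Eu; apply/BW/zadjoin_sub.
have Wqx : W (x *+ q) by apply/BW/zadjoin_gen.
have tD := opcore_torsion sW (avoiding_torsion maxW pr_q Wqx).
case: (maxW) => _ + _; apply; apply: opcore_sub.
apply: no_quotient => [||||u]; [exact: zsubgroup_opcore|exact: invariant_opcore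
  |exact: opcore_max|move=> u|].
  by have [k hk] := tD u; exists (q ^ k)%N; rewrite ?expn_gt0 ?prime_gt0.
have [k hk] := tD u; have sD := zsubgroup_opcore sW.
have co : coprime p (q ^ k) by rewrite coprimeXr // prime_coprime // dvdn_prime2 // eq_sym.
have [a b e _] := egcdnP (q ^ k) (prime_gt0 pr_p).
exists (u *+ a); rewrite -mulrnA e (eqP co) mulrnDr mulr1n opprD addrCA subrr addr0.
by apply: (zsubN sD); rewrite mulnC mulrnA; apply: (zsubMn sD).
Qed.

Lemma torsion_primary x : exists k, E (x *+ p ^ k).
Proof.
(* Any prime other than [p] serves to get a first [m], positive because it is prime to [q]. Taking
   gcds then removes the prime factors of [m] other than [p]. *)
pose q : nat := if p == 2%N then 3%N else 2%N.
have [m co Em] : exists2 m, (0 < m)%N & E (x *+ m).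
  have [||m co hm] := @torsion_prime_to q x; first by rewrite /q; case: ifP.
    by rewrite /q; case: ifP => [/eqP->|/negbT]//; rewrite eq_sym.
  exists m => //; case: m co {hm} => //; rewrite /q; by case: ifP.
elim/ltn_ind: m co Em => m IH m0 Em.
have [/p_natP[k ek]|] := boolP (p.-nat m); first by exists k; rewrite -ek.
rewrite /pnat m0 /= => /allPn[r]; rewrite mem_primes => /and3P[pr_r _ rm] nrp.
have [m' co Em'] := torsion_prime_to x pr_r nrp.
apply: (IH (gcdn m m')); last exact: zsub_gcd; last by rewrite gcdn_gt0 m0.
rewrite ltn_neqAle dvdn_leq ?dvdn_gcdl // andbT; apply/eqP => e.
have : (r %| gcdn m m')%N by rewrite e.
rewrite dvdn_gcd => /andP[_ rm']; move: co.
by rewrite coprime_sym prime_coprime // rm'.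
Qed.

(** Otherwise [M / W] is quasicyclic. With [D] the core of [W], some [p ^ m (M / D)] is
    [p]-divisible; it is isomorphic to [M] modulo the [x] with [p ^ m x] in [D], so [no_quotient]
    makes it zero. *)
Lemma avoiding_bounded y W : maximal_avoiding y W -> W (y *+ p) ->
  (forall x, E x -> W x) -> exists k, forall x, W (x *+ p ^ k).
Proof.
move=> maxW Wpy EW; apply: contrapT => nb.
have sW : zsubgroup W by case: maxW.
have nWy : ~ W y by case: maxW.
have unb k : exists x, ~ W (x *+ p ^ k).
  by apply: contrapT => h; apply: nb; exists k => x; apply: contrapT => nW; apply: h;
    exists x.
have tW := avoiding_torsion maxW pr_p Wpy.
(* For [x] outside [W], [y] is [j x] modulo [W] with [j] prime to [p], since [y] is nonzero there;
   inverting [j] modulo [p] expresses [x] by [y]. *)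
have socle x : W (x *+ p) -> exists k : int, W (x - y *~ k).
  move=> Wpx; have [Wx|nWx] := pselect (W x); first by exists 0; rewrite mulr0z subr0.
  have [j hj] := avoiding_multiple maxW nWx.
  have co : coprimez j p.
    rewrite coprimezE coprime_sym prime_coprime //; apply/negP => /dvdnP[i ei].
    apply: nWy; apply: (zsub_mem sW hj); apply/(zsub_absz sW).
    by rewrite ei mulnC mulrnA; apply: zsubMn.
  have [[u v] /= e] := coprimezP _ _ co; exists u.
  apply: (zsub_trans sW (y := x *~ j *~ u)); last by apply: (zsub_congMz sW);
    apply: (zsubC sW).
  rewrite -mulrzA -{1}[x]mulr1z -mulrzBr -e [j * u]mulrC addrC addKr mulrC mulrzA.
  exact: zsubMz.
(* Multiplication by [p] lowers [n]. The error left by the induction hypothesis is killed by [p],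
   hence a multiple of [y], and [y] is a multiple of [a]. *)
have cyclic n a b : ~ W (a *+ p ^ n) -> W (b *+ p ^ n.+1) -> exists k : int, W (b - a *~ k).
  elim: n a b => [|n IH] a b nWa Wb.
    have [k hk] := socle _ Wb; have [j hj] := avoiding_multiple maxW nWa.
    exists (j * k); rewrite mulrzA.
    exact: (zsub_trans sW hk (zsub_congMz sW k hj)).
  have [||k hk] := IH (a *+ p) (b *+ p); rewrite -?mulrnA -?expnS //.
  have [|k' hk'] := socle (b - a *~ k).
    by rewrite mulrnBl (pmulrn (a *~ k)) mulrzAC -pmulrn.
  have [Wa|j hj] := avoiding_multiple maxW (x := a).
    by apply: nWa; apply: zsubMn.
  exists (k + j * k'); rewrite mulrzDr mulrzA opprD addrA.
  exact: (zsub_trans sW hk' (zsub_congMz sW k' hj)).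
(* By [cyclic], an element of [S] of large order generates every element of smaller order modulo
   [W]. *)
have dicho S : zsubgroup S -> (exists j, forall s, S s -> W (s *+ p ^ j)) \/
    (forall x, exists2 s, S s & W (x - s)).
  move=> sS; have [h|h] := pselect (exists j, forall s, S s -> W (s *+ p ^ j));
    first by left.
  right=> x; have [n hn] := tW x.
  have [s [Ss nWs]] : exists s, S s /\ ~ W (s *+ p ^ n).
    apply: contrapT => none; apply: h; exists n => s Ss.
    by apply: contrapT => nW; apply: none; exists s.
  have [|k hk] := cyclic n s x nWs; last by exists (s *~ k) => //; apply: zsubMz.
  by apply: zsub_dvd hn; rewrite // dvdn_exp2l.
have div x : exists u, W (x - u *+ p).
  have [|[j hj]|h] := dicho (fun s => exists u, s = u *+ p).
  - split=> [|_ _ [u ->] [v ->]]; first by exists 0; rewrite mul0rn.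
    by exists (u - v); rewrite mulrnBl.
  - have [u] := unb j.+1; case; rewrite expnS mulrnA; apply: hj; by exists u.
  - by have [_ [u ->] hu] := h x; exists u.
(* The operators are treated one at a time, [D'] being the intersection of the earlier preimages of
   [W]. If the image of [D'] under [g] is bounded modulo [W], the bound is added to [m]. Otherwise
   it covers the divisible group [M / W], and [u] is corrected by an [s] in [D'], which preserves
   the earlier conditions. *)
have stab (l : seq G) : exists m, forall x, exists u, forall g, g \in l ->
    W (act g (x *+ p ^ m - u *+ p ^ m.+1)).
  elim: l => [|g l [m hm]]; first by exists 0%N => x; exists 0.
  pose D' x := forall h, h \in l -> W (act h x).
  have sD' : zsubgroup D'.
    split=> [|x u hx hu] h lh; rewrite ?raddf0 ?raddfB; first exact: zsub0.
    by apply: zsubB; [|apply: hx|apply: hu].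
  have [|[j hj]|hS] := dicho (fun s => exists2 x, D' x & s = act g x).
  - split=> [|_ _ [u hu ->] [v hv ->]]; first by exists 0;
    [exact: (zsub0 sD')|rewrite raddf0].
    by exists (u - v); [exact: (zsubB sD')|rewrite raddfB].
  - exists (m + j)%N => x; have [u hu] := hm x; exists u => h.
    have -> : x *+ p ^ (m + j) - u *+ p ^ (m + j).+1 =
              (x *+ p ^ m - u *+ p ^ m.+1) *+ p ^ j.
      by rewrite mulrnBl -!mulrnA -!expnD addSn.
    rewrite raddfMn inE => /predU1P[->|lh]; last by apply: (zsubMn sW); apply: hu.
    by apply: hj; exists (x *+ p ^ m - u *+ p ^ m.+1).
  - exists m => x; have [u hu] := hm x; set d := x *+ _ - _ in hu.
    have iter i : exists2 s, D' s & W (act g d - act g s *+ p ^ i).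
      elim: i => [|i [s D's hs]].
        by exists d => //; rewrite mulr1n subrr; apply: zsub0.
      have [v hv] := div (act g s); have [_ [s' D's' ->] hs'] := hS v.
      exists s' => //; apply: (zsub_trans sW hs); rewrite expnS mulrnA.
      by apply: (zsub_congMn sW); apply: (zsub_trans sW hv); apply: (zsub_congMn sW).
    have [s D's hs] := iter m.+1; exists (u + s) => h.
    rewrite mulrnDl opprD addrA -/d raddfB raddfMn inE => /predU1P[->//|lh].
    by apply: zsubB; [|apply: hu|apply: (zsubMn sW); apply: D's].
have [l hl] := act_finite; have [m hm] := stab l.
pose D := opcore W; have sD : zsubgroup D by apply: zsubgroup_opcore.
have [x] := unb m; case; apply: opcore_sub; rewrite -/D.
apply: (no_quotient (B := fun x => D (x *+ p ^ m))) => [|g u hu|u Eu|u|u].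
- by split=> [|u v hu hv]; rewrite ?mul0rn ?mulrnBl;
  [apply: (zsub0 sD)|apply: (zsubB sD)].
- by rewrite -raddfMn; apply: invariant_opcore.
- by apply: (zsubMn sD); apply: opcore_max Eu.
- have [k hk] := torsion_primary u; exists (p ^ k)%N;
  first by rewrite expn_gt0 prime_gt0.
  by apply: (zsubMn sD); apply: opcore_max hk.
- have [v hv] := hm u; exists v; rewrite mulrnBl -mulrnA -expnS => g.
  by have [h lh ->] := hl g; apply: hv.
Qed.

(* The pairs [(B, y)] built below approximate a quasicyclic quotient of [M]:
   modulo [B] the element [y] is an [n]-fold [p]-th root of [y0]. *)
Definition root_approx y0 n (s : (M -> Prop) * M) :=
  [/\ zsubgroup s.1, forall x, E x -> s.1 x,
      exists c, forall b, s.1 b -> E (b *+ p ^ c),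
      ~ s.1 y0 & s.1 (s.2 *+ p ^ n - y0)].

(** Choose [e] of large order inside a subgroup [W] that avoids [y0], and kill [f = y - p e], so
    that [e] becomes a [p]-th root of [y]. If [y0] were [k f] modulo [B], then [p ^ n.+1] would
    divide [k], so [k y] would lie in [B] and [y0] in [W]. *)
Lemma root_approx_step y0 n s : (forall k, exists x, ~ E (x *+ p ^ k)) -> E (y0 *+ p) ->
  root_approx y0 n s ->
  exists s', root_approx y0 n.+1 s' /\ forall x, s.1 x -> s'.1 x.
Proof.
case: s => B y unb Epy [/= sB EB [c hc] nBy By].
have [W [maxW BW]] := exists_maximal_avoiding sB nBy.
have sW : zsubgroup W by case: maxW.
have [||N hN] := avoiding_bounded maxW; [by apply/BW/EB|by move=> x /EB/BW|].
have [d hd] := torsion_primary y.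
(* The factor [p ^ N] brings [a] into [W]; the remaining exponent keeps [p ^ n.+1 e] outside the
   span of [B] and [y], which [p ^ (c + d)] maps into [E]. *)
have [a ha] := unb (N + n.+1 + (c + d))%N.
pose e := a *+ p ^ N; have We : W e by apply: hN.
have sA := zsubgroup_adjoin y sB.
have nAe : ~ zadjoin B y (e *+ p ^ n.+1).
  case=> k hk; apply: ha; rewrite expnD mulrnA expnD mulrnA -/e expnD mulrnA.
  apply: (zsub_mem sE (y := y *~ k *+ p ^ c *+ p ^ d)).
    by rewrite -mulrnBl -mulrnBl; apply: (zsubMn sE); apply: hc.
  rewrite -mulrnA mulnC mulrnA; apply: (zsubMn sE).
  by rewrite pmulrn mulrzAC; apply: (zsubMz sE); rewrite -pmulrn.
pose f := y - e *+ p; exists (zadjoin B f, e); split=> [|x /=]; last exact: zadjoin_sub.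
split=> /=.
- exact: zsubgroup_adjoin.
- by move=> x Ex; apply/zadjoin_sub/EB.
- have [j hj] := torsion_primary f; exists (c + j)%N => b [k hk].
  rewrite expnD mulrnA; apply: (zsub_mem sE (y := f *~ k *+ p ^ c *+ p ^ j)).
    by rewrite -mulrnBl -mulrnBl; apply: (zsubMn sE); apply: hc.
  rewrite -mulrnA mulnC mulrnA; apply: (zsubMn sE).
  by rewrite pmulrn mulrzAC; apply: (zsubMz sE); rewrite -pmulrn.
(* Modulo [B] and [y], the order of [e] is a power of [p] above [p ^ n.+1], and it divides [k p]. *)
- case=> k hk; have pk : (p ^ n.+1 %| `|k|)%N.
    have [j hj] := torsion_primary e.
    have Ae : zadjoin B y (e *+ (`|k| * p)).
      rewrite mulnC mulrnA; apply/(zsub_absz sA); exists (k - (p ^ n)%:Z).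
      have -> : e *+ p *~ k - y *~ (k - (p ^ n)%:Z) =
                (y0 - f *~ k) + (y *+ p ^ n - y0).
        rewrite /f mulrzBr mulrzBl -pmulrn !opprB addrA [_ + (_ - y0)]addrC addrA.
        by rewrite subrK addrCA addrA.
      exact: (zsubD sB).
    have Ae' : zadjoin B y (e *+ p ^ j) by apply/zadjoin_sub/EB.
    have := zsub_gcd sA Ae Ae'.
    have /(dvdn_pfactor _ _ pr_p)[v _ ev] := dvdn_gcdr (`|k| * p) (p ^ j).
    rewrite ev => Av; have [le_v|lt_v] := leqP v n.+1.
      by case: nAe; apply: (zsub_dvd sA _ Av); rewrite dvdn_exp2l.
    rewrite -(dvdn_pmul2r (prime_gt0 pr_p)) -expnSr.
    apply: dvdn_trans (dvdn_exp2l p lt_v) _; rewrite -ev; exact: dvdn_gcdl.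
  have Bk : B (y *~ k).
    apply/(zsub_absz sB)/(zsub_dvd sB pk); rewrite expnSr mulrnA.
    apply: (zsub_mem sB (zsub_congMn sB p By)); exact: EB.
  case: maxW => _ + _; apply; apply: (zsub_mem sW (BW _ hk)).
  rewrite /f mulrzBl; apply: (zsubB sW); first exact: BW.
  by apply: (zsubMz sW); apply: (zsubMn sW).
- exists (- (p ^ n)%:Z); rewrite mulrNz opprK -pmulrn /f mulrnBl -[e *+ p *+ _]mulrnA.
  by rewrite -expnS [X in B X]addrC addrA subrK.
Qed.

(** If unbounded, iterating [root_approx_step] gives a union [B] modulo which [y0] is nonzero and
    has [p ^ n]-th roots for all [n]. A subgroup maximal without [y0] above [B] has a quotient
    killed by some [p ^ N]; this kills the [N]-th root's multiple [y0]. *)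
Lemma primary_bounded : exists k, forall x, E (x *+ p ^ k).
Proof.
apply: contrapT => nb.
have unb k : exists x, ~ E (x *+ p ^ k).
  by apply: contrapT => h; apply: nb; exists k => x; apply: contrapT => nE; apply: h;
    exists x.
have [y0 nEy0 Epy0] : exists2 y0, ~ E y0 & E (y0 *+ p).
  have [x nEx] := unb 0%N; have [k] := torsion_primary x.
  elim: k => [//|k IH]; have [|nEk] := pselect (E (x *+ p ^ k)); first by move=> /IH.
  by rewrite expnSr mulrnA; exists (x *+ p ^ k).
have init : root_approx y0 0 (E, y0).
  split=> //=; last by rewrite mulr1n subrr; apply: (zsub0 sE).
  by exists 0%N => b; rewrite mulr1n.
have [F hF] : exists F : nat -> (M -> Prop) * M -> (M -> Prop) * M,
    forall n s, root_approx y0 n s ->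
      root_approx y0 n.+1 (F n s) /\ forall x, s.1 x -> (F n s).1 x.
  have /choice[F hF] : forall ns : nat * ((M -> Prop) * M), exists s',
      root_approx y0 ns.1 ns.2 ->
      root_approx y0 ns.1.+1 s' /\ forall x, ns.2.1 x -> s'.1 x.
    case=> n s /=;
      have [/(root_approx_step unb Epy0)[s' hs']|nr] := pselect (root_approx y0 n s).
      by exists s'.
    (* A default value: [F] must be total, so pairs that are not approximations are left
       unchanged. *)
    by exists s.
  by exists (fun n s => F (n, s)) => n s hs; apply: (hF (n, s)).
pose S := fix S n := if n is n'.+1 then F n' (S n') else (E, y0).
have SP n : root_approx y0 n (S n) by elim: n => //= n IH; apply: (hF _ _ IH).1.
have mono m n x : (m <= n)%N -> (S m).1 x -> (S n).1 x.
  move/subnK <-; elim: (n - m)%N => [//|k IH] /IH; exact: (hF _ _ (SP _)).2.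
pose B x := exists n, (S n).1 x.
have sB : zsubgroup B.
  split=> [|x y [m hm] [n hn]]; first by exists 0%N; apply: (zsub0 sE).
  exists (maxn m n); case: (SP (maxn m n)) => /zsubB + _ _ _ _; apply.
    exact: mono (leq_maxl _ _) hm.
  exact: mono (leq_maxr _ _) hn.
have nBy : ~ B y0 by case=> n; case: (SP n).
have [W [maxW BW]] := exists_maximal_avoiding sB nBy.
have EB x : E x -> B x by exists 0%N.
have [||N hN] := avoiding_bounded maxW; [by apply/BW/EB|by move=> x /EB/BW|].
have sW : zsubgroup W by case: maxW.
case: (maxW) => _ + _; apply; apply: (zsub_memr sW _ (hN (S N).2)).
by apply: BW; exists N; case: (SP N).
Qed.

End PrimaryCore.

(** * The augmentation filtration and central operators *)

Definition zspan (S : M -> Prop) : M -> Prop :=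
  fun x => forall B, zsubgroup B -> (forall u, S u -> B u) -> B x.

Lemma zsubgroup_span S : zsubgroup (zspan S).
Proof.
split=> [B sB _|x y hx hy B sB SB]; first exact: zsub0.
by apply: (zsubB sB); [apply: hx|apply: hy].
Qed.

Lemma zspan_gen S x : S x -> zspan S x.
Proof. by move=> Sx B _; apply. Qed.

Definition aug (U : M -> Prop) : M -> Prop :=
  zspan (fun v => exists g u, U u /\ v = act g u - u).

(** [I ^ k M], where [I] is the augmentation ideal. *)
Definition augn := fix augn k := if k is k'.+1 then aug (augn k') else fun _ : M => True.

Lemma aug_gen (U : M -> Prop) g u : U u -> aug U (act g u - u).
Proof. by move=> Uu; apply: zspan_gen; exists g, u. Qed.

Lemma aug_ind (U C : M -> Prop) : zsubgroup C ->
  (forall g u, U u -> C (act g u - u)) -> forall x, aug U x -> C x.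
Proof. by move=> sC h x; apply=> // _ [g [u [Uu ->]]]; apply: h. Qed.

Lemma zsubgroup_augn k : zsubgroup (augn k).
Proof. by case: k => [|k] //=; apply: zsubgroup_span. Qed.

(** The sum [D + (z - 1) M]; no span is taken because [(z - 1) M] is already a subgroup. *)
Definition operator_join (D : M -> Prop) z : M -> Prop :=
  fun x => exists m, D (x - (act z m - m)).

Section CentralOperator.
Variables (D : M -> Prop) (z : G).
Hypotheses (sD : zsubgroup D) (iD : invariant D).
Hypothesis z_central : forall g m, D (act g (act z m) - act z (act g m)).
Let t m := act z m - m.
Let tn n := iter n t.

Let tB x y : t (x - y) = t x - t y.
Proof. by rewrite /t raddfB subrBB. Qed.
Let t0 : t 0 = 0. Proof. by rewrite /t raddf0 subrr. Qed.
Let tMn x n : t (x *+ n) = t x *+ n. Proof. by rewrite /t raddfMn mulrnBl. Qed.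
Let tnB n x y : tn n (x - y) = tn n x - tn n y.
Proof. by elim: n => //= n ->. Qed.
Let tnz n : tn n 0 = 0. Proof. by elim: n => //= n ->. Qed.
Let tnMn n x k : tn n (x *+ k) = tn n x *+ k.
Proof. by elim: n => //= n ->. Qed.
Let Dt x : D x -> D (t x).
Proof. by move=> Dx; apply: (zsubB sD) => //; apply: iD. Qed.
Let Dtn n x : D x -> D (tn n x).
Proof. by move=> Dx; elim: n => //= n; apply: Dt. Qed.
Let t_central g m : D (act g (t m) - t (act g m)).
Proof. by rewrite /t raddfB opprB addrA subrK. Qed.
Let tn_central n g m : D (act g (tn n m) - tn n (act g m)).
Proof.
elim: n => [|n IH] /=; first by rewrite subrr; apply: (zsub0 sD).
by apply: (zsub_trans sD (t_central _ _)); rewrite -tB; apply: Dt.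
Qed.

Lemma operator_join_sub x : D x -> operator_join D z x.
Proof. by move=> Dx; exists 0; rewrite raddf0 subrr subr0. Qed.

Lemma zsubgroup_join : zsubgroup (operator_join D z).
Proof.
split=> [|x y [m hm] [m' hm']]; first by apply: operator_join_sub; apply: (zsub0 sD).
exists (m - m'); rewrite raddfB [act z m - _ - _]subrBB; exact: (zsub_congB sD).
Qed.

Lemma invariant_join : invariant (operator_join D z).
Proof.
move=> g x [m hm]; exists (act g m); apply: (zsub_trans sD (y := act g (t m))) => //.
by rewrite -raddfB; apply: iD.
Qed.

Lemma act_expS n m : act (z ^+ n.+1)%g m = act z (act (z ^+ n)%g m).
Proof. by rewrite expgSr actM. Qed.

(** Binomial theorem for [z = 1 + t], by Pascal's rule. *)
Lemma act_exp_binomial n m :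
  act (z ^+ n)%g m = \sum_(i < n.+1) tn i m *+ 'C(n, i).
Proof.
elim: n => [|n IH]; first by rewrite act1 big_ord_recl big_ord0 addr0 bin0 mulr1n.
have zt x : act z x = t x + x by rewrite subrK.
rewrite act_expS IH raddf_sum /=.
under eq_bigr do rewrite raddfMn zt mulrnDl.
rewrite big_split /= [RHS]big_ord_recl /= !bin0.
under [in RHS]eq_bigr do rewrite binS mulrnDr.
rewrite big_split /= [LHS]addrC [RHS]addrA; congr (_ + _).
rewrite big_ord_recl bin0; congr (_ + _).
by rewrite [RHS]big_ord_recr /= bin_small // mulr0n addr0.
Qed.

(** Modulo [D], [t] commutes with all operators. So if [I ^ (j k) M] lies in [t ^ j M + D], then
    [I ^ (i + j k) M] lies in [t ^ j I ^ i M + D]; for [i = k] this is inside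
    [t ^ (j + 1) M + D]. *)
Lemma central_nilpotent_descent k n :
  (forall m, D (tn n m)) -> (forall x, augn k x -> operator_join D z x) ->
  exists k', forall x, augn k' x -> D x.
Proof.
move=> tn0 hk.
suff h j : forall x, augn (j * k) x -> exists m, D (x - tn j m).
  exists (n * k)%N => x /h[m hm]; exact: (zsub_mem sD hm).
elim: j => [|j IH] x; first by exists x; rewrite subrr; apply: (zsub0 sD).
suff {x} h i x : augn (i + j * k) x -> exists2 m, augn i m & D (x - tn j m).
  move/h=> [m /hk[m' hm'] hm]; exists m'; apply: (zsub_trans sD hm).
  by rewrite [tn j.+1 _]iterSr -tnB; apply: Dtn.
elim: i x => [|i IHi] x /=; first by move/IH=> [m hm]; exists m.
have sC : zsubgroup (fun x => exists2 m, aug (augn i) m & D (x - tn j m)).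
  have sA := zsubgroup_augn i.+1.
  split=> [|u v [m hm Dm] [m' hm' Dm']].
    exists 0; first exact: (zsub0 sA).
    by rewrite tnz subrr; apply: (zsub0 sD).
  exists (m - m'); first exact: (zsubB sA).
  by rewrite tnB; apply: (zsub_congB sD).
apply: (aug_ind sC) => g u /IHi[m hm Dm]; exists (act g m - m); first exact: aug_gen.
rewrite tnB; apply: (zsub_congB sD) => //;
  apply: (zsub_trans sD (y := act g (tn j m))) => //.
by rewrite -raddfB; apply: iD.
Qed.

End CentralOperator.

(** * Nilpotency of the augmentation action *)

Section NoPerfectQuotient.
Hypothesis no_perfect : forall B : M -> Prop, zsubgroup B -> invariant B ->
  (forall x, exists2 n, (0 < n)%N & B (x *+ n)) ->
  (forall C : M -> Prop, zsubgroup C -> (forall x, B x -> C x) ->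
     (forall g x, C (act g x - x)) -> forall x, C x) ->
  forall x, B x.

(** With [E] the kernel of [t] modulo [D], [primary_bounded] puts [p ^ k M] inside [E]. As [t ^ p M]
    lies in [p M + D], [t ^ (k p)] maps into [p ^ k M + D], and one more [t] lands in [D]. *)
Lemma central_prime_nilpotent (D : M -> Prop) (z : G) (p : nat) :
  zsubgroup D -> invariant D ->
  (forall g m, D (act g (act z m) - act z (act g m))) ->
  prime p -> (forall m, D (act (z ^+ p)%g m - m)) ->
  exists n, forall m, D (iter n (fun m => act z m - m) m).
Proof.
move=> sD iD zC pr_p zp; pose t m := act z m - m.
have tB x y : t (x - y) = t x - t y by rewrite /t raddfB subrBB.
have tMn x n : t (x *+ n) = t x *+ n by rewrite /t raddfMn mulrnBl.
have tnB n x y : iter n t (x - y) = iter n t x - iter n t y.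
  by elim: n => //= n ->.
have tnMn n x k : iter n t (x *+ k) = iter n t x *+ k by elim: n => //= n ->.
have Dt x : D x -> D (t x) by move=> Dx; apply: (zsubB sD) => //; apply: iD.
have Dtn n x : D x -> D (iter n t x) by move=> Dx; elim: n => //= n; apply: Dt.
pose E m := D (t m).
have sE : zsubgroup E.
  split=> [|x y Ex Ey]; rewrite /E; last by rewrite tB; apply: (zsubB sD).
  by rewrite /t raddf0 subrr; apply: (zsub0 sD).
have iE : invariant E.
  move=> g x Ex; rewrite /E; apply: (zsub_memr sD _ (iD g _ Ex)).
  by rewrite /t raddfB opprB addrA subrK.
have norm n y : t (\sum_(i < n) act (z ^+ i)%g y) = act (z ^+ n)%g y - y.
  elim: n => [|n IH]; first by rewrite big_ord0 act1 /t raddf0 !subrr.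
  rewrite big_ord_recr /= -[X in t (_ + X)]opprK tB IH -[X in t X]sub0r tB.
  by rewrite /t raddf0 subrr sub0r opprK -act_expS addrC addrA subrK.
have [|k hk] := @primary_bounded p E pr_p sE iE.
  (* Modulo [B], [x] is some [p y]. Modulo the augmentation, [p y] is the norm of [y], and the norm
     lies in [E] because [z ^ p] is trivial modulo [D]. *)
  move=> B sB iB EB tB' div; apply: no_perfect => // C sC BC augC x.
  have [y hy] := div x; apply: (zsub_mem sC (BC _ hy)).
  apply: (zsub_mem sC (y := \sum_(i < p) act (z ^+ i)%g y)); last first.
    by apply/BC/EB; rewrite /E norm.
  elim: p {pr_p zp div hy} => [|n IH]; first by rewrite big_ord0 subrr;
    apply: (zsub0 sC).
  rewrite mulrSr big_ord_recr /=; apply: (zsub_congD sC) => //; exact: (zsubC sC).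
have tp m : exists u, D (iter p t m - u *+ p).
  have := zp m; rewrite (act_exp_binomial z).
  case: p pr_p {zp hk} => // p pr_p.
  rewrite big_ord_recl /= bin0 mulr1n addrC addKr big_ord_recr /= binn mulr1n => h.
  (* The prime is now written [p.+1]; it divides its inner binomial coefficients, and the sign comes
     from moving these terms across the expansion. *)
  exists (- \sum_(i < p) iter i.+1 t m *+ ('C(p.+1, i.+1) %/ p.+1)).
  rewrite mulNrn opprK -sumrMnl addrC.
  rewrite (eq_bigr (fun i : 'I_p => iter i.+1 t m *+ 'C(p.+1, i.+1))) // => i _.
  by rewrite -mulrnA divnK // prime_dvd_bin //= ltnS ltn_ord.
have tpk j m : exists u, D (iter (j * p) t m - u *+ p ^ j).
  elim: j => [|j [u hu]]; first by exists m; rewrite mulr1n subrr; apply: (zsub0 sD).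
  have [v hv] := tp u; exists v; rewrite mulSn iterD.
  apply: (zsub_trans sD (y := iter p t (u *+ p ^ j))); first by rewrite -tnB;
    apply: Dtn.
  by rewrite tnMn expnS mulrnA; apply: (zsub_congMn sD).
exists (k * p).+1 => m; have [u hu] := tpk k m; rewrite iterS.
by apply: (zsub_mem sD (y := t (u *+ p ^ k))); [rewrite -tB; apply: Dt|apply: hk].
Qed.

(** Induction on [n]: for a prime [p] dividing [n], [z' = z ^ (n / p)] has [z' - 1] nilpotent modulo
    [D], and modulo [D + (z' - 1) M] the exponent of [z] drops to [n / p]. *)
Lemma central_descent (D : M -> Prop) (z : G) n k : zsubgroup D -> invariant D ->
  (forall g m, D (act g (act z m) - act z (act g m))) ->
  (0 < n)%N -> (forall m, D (act (z ^+ n)%g m - m)) ->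
  (forall x, augn k x -> operator_join D z x) ->
  exists k', forall x, augn k' x -> D x.
Proof.
elim/ltn_ind: n D k => n IH D k sD iD zC n0 zn hk.
have [n1|] := leqP n 1.
  have e : n = 1%N by apply/eqP; rewrite eqn_leq n1.
  exists k => x /hk[m hm]; apply: (zsub_mem sD hm).
  by have := zn m; rewrite e.
move=> n1; pose p := pdiv n; have pr_p : prime p by apply: pdiv_prime.
pose n' := (n %/ p)%N; have en : (n' * p)%N = n by rewrite divnK // pdiv_dvd.
pose z' := (z ^+ n')%g.
have zC' g m : D (act g (act z' m) - act z' (act g m)).
  rewrite /z'; elim: n' {en z'} => [|j IHj] in m *.
    by rewrite !act1 subrr; apply: (zsub0 sD).
  rewrite !act_expS; apply: (zsub_trans sD (zC _ _)).
  by rewrite -raddfB; apply: iD.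
have zp' m : D (act (z' ^+ p)%g m - m) by rewrite /z' -expgnA en.
have [j hj] := central_prime_nilpotent sD iD zC' pr_p zp'.
pose D' := operator_join D z'; have DD' := @operator_join_sub D z'.
have sD' : zsubgroup D' := zsubgroup_join z' sD.
have iD' : invariant D' := invariant_join sD iD zC'.
have n'_lt : (n' < n)%N by rewrite ltn_Pdiv ?prime_gt1.
have n'_gt0 : (0 < n')%N by rewrite divn_gt0 ?prime_gt0 // dvdn_leq ?pdiv_dvd.
have [|m|x /hk[m hm]|k' hk'] := IH n' n'_lt D' k sD' iD' _ n'_gt0.
- by move=> g m; apply: DD'; apply: zC.
- by exists m; rewrite subrr; apply: (zsub0 sD).
- by exists m; apply: DD'.
- exact: central_nilpotent_descent hj hk'.
Qed.

Lemma list_descent (zs : seq G) (D : M -> Prop) k : zsubgroup D -> invariant D ->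
  (forall z g m, z \in zs -> D (act g (act z m) - act z (act g m))) ->
  (forall z, z \in zs -> exists2 n, (0 < n)%N & forall m, act (z ^+ n)%g m = m) ->
  (forall x, augn k x ->
     zspan (fun v => D v \/ exists z m, z \in zs /\ v = act z m - m) x) ->
  exists k', forall x, augn k' x -> D x.
Proof.
elim: zs D k => [|z zs IH] D k sD iD zC zfin hk.
  by exists k => x /hk; apply=> // v [//|[z [m []]]].
have zC0 g m : D (act g (act z m) - act z (act g m)) by apply: zC; rewrite mem_head.
have [n n0 zn] := zfin z (mem_head _ _).
have sD' := zsubgroup_join z sD; have DD' := @operator_join_sub D z.
have [|||k' hk'] := IH (operator_join D z) k sD' (invariant_join sD iD zC0).
- by move=> y g m yzs; apply: DD'; apply: zC; rewrite inE yzs orbT.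
- by move=> y yzs; apply: zfin; rewrite inE yzs orbT.
- move=> x /hk; apply; first exact: zsubgroup_span.
  move=> v [Dv|[y [m [+ ->]]]]; first by apply: zspan_gen; left; apply: DD'.
  rewrite inE => /predU1P[->|yzs]; apply: zspan_gen.
    by left; exists m; rewrite subrr; apply: (zsub0 sD).
  by right; exists y, m.
- apply: (central_descent sD iD zC0 n0 _ hk') => m; rewrite zn subrr; exact: (zsub0 sD).
Qed.

(** Each listed operator is replaced by an element of [P] acting alike, or dropped when there is
    none. *)
Lemma act_finite_cover (P : G -> Prop) : exists2 l : seq G,
  forall h, h \in l -> P h & forall g, P g -> exists2 h, h \in l & act g =1 act h.
Proof.
have [l0 hl0] := act_finite.
suff [l lP hl] : exists2 l : seq G, forall h, h \in l -> P h &
    forall g, P g -> (exists2 h, h \in l0 & act g =1 act h) ->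
    exists2 h, h \in l & act g =1 act h.
  by exists l => // g Pg; apply: hl.
elim: l0 {hl0} => [|h0 l0 [l lP hl]]; first by exists [::] => // g _ [].
have [[g0 Pg0 e0]|none] := pselect (exists2 g, P g & act g =1 act h0).
  exists (g0 :: l) => [h|g Pg [h]]; first by rewrite inE => /predU1P[->|/lP].
  rewrite inE => /predU1P[->|hin] e; first by exists g0; rewrite ?mem_head // => m;
    rewrite e e0.
  by have [|h' h'in e'] := hl g Pg; [exists h|exists h'; rewrite // inE h'in orbT].
exists l => // g Pg [h]; rewrite inE => /predU1P[->|hin] e; last by apply: hl => //;
  exists h.
by case: none; exists g.
Qed.

(** [L] is a central series whose last term acts trivially. Modulo [D j.+1], spanned by the
    [(g - 1) M] with [g] in [L j.+1], elements of [L j] act centrally, so [list_descent] passes from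
    [D j] to [D j.+1]; finally [D c = 0]. *)
Lemma augn_eq0 (L : nat -> G -> Prop) c :
  (forall g, L 0%N g) -> (forall j g h, L j g -> L j (g ^ h)%g) ->
  (forall j z g, L j z -> L j.+1 [~ z, g]%g) -> (forall g, L c g -> act g =1 id) ->
  (forall z, exists2 n, (0 < n)%N & forall m, act (z ^+ n)%g m = m) ->
  exists k, forall x, augn k x -> x = 0.
Proof.
move=> L0 Lconj Lcomm Lc zfin.
pose D j := zspan (fun v => exists g m, L j g /\ v = act g m - m).
have sD j : zsubgroup (D j) by apply: zsubgroup_span.
have iD j : invariant (D j).
  move=> h x Dx; apply: (Dx (fun x => D j (act h x))).
    by split=> [|u v]; rewrite ?raddf0 ?raddfB;
      [apply: (zsub0 (sD j))|apply: (zsubB (sD j))].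
  move=> _ [g [m [Lg ->]]]; apply: zspan_gen; exists (g ^ h)%g, (act h m).
  split; first exact: Lconj.
  by rewrite raddfB -!actM -conjgC.
suff [k hk] : exists k, forall x, augn k x -> D c x.
  exists k => x /hk h; apply: (h (fun x => x = 0)).
    by split=> // u v -> ->; rewrite subrr.
  by move=> _ [g [m [/Lc -> ->]]]; rewrite subrr.
elim: c {Lc} => [|j [k hk]].
  exists 1%N; apply: aug_ind => // g u _; apply: zspan_gen; exists g, u; by split.
have [zs zsL zsC] := act_finite_cover (L j).
apply: (@list_descent zs (D j.+1) k) => // [z g m zin|x /hk].
  (* The action is on the right, and [z * g = g * z * [~ z, g]]. *)
  apply: zspan_gen; exists [~ z, g]%g, (act z (act g m)); split;
    first by apply/Lcomm/zsL.
  by rewrite -!actM -commgC.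
apply; first exact: zsubgroup_span.
move=> _ [g [m [/zsC[z zin e] ->]]]; apply: zspan_gen; right; exists z, m.
by rewrite e.
Qed.

End NoPerfectQuotient.

End FiniteAction.

(** * Finitely generated torsion quotients are finite *)

Section FiniteSpan.
Variables (M : zmodType) (B : M -> Prop).
Hypotheses (sB : zsubgroup B) (tB : forall x, exists2 n, (0 < n)%N & B (x *+ n)).

Lemma zspan_finite (s : seq M) : exists l : seq M, forall v,
  zspan (fun u => B u \/ u \in s) v -> exists2 a, a \in l & B (v - a).
Proof.
pose V s := foldr (fun e V => zadjoin V e) B s.
have sV r : zsubgroup (V r) by elim: r => //= e r; apply: zsubgroup_adjoin.
have VB r u : B u -> V r u by move=> Bu; elim: r => //= e r; apply: zadjoin_sub.
have Vs r u : u \in r -> V r u.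
  elim: r => //= e r IH; rewrite inE => /predU1P[->|/IH].
    exact: zadjoin_gen.
  exact: zadjoin_sub.
suff [l hl] : exists l : seq M, forall v, V s v -> exists2 a, a \in l & B (v - a).
  exists l => v hv; apply: hl; apply: hv => // u [Bu|us]; [exact: VB|exact: Vs].
elim: s => [|e s [l hl]].
  by exists [:: 0] => v Bv; exists 0; rewrite ?mem_head // subr0.
have [n n0 Bn] := tB e.
exists [seq a + e *+ i | a <- l, i <- iota 0 n] => v [k /hl[a la Ba]].
pose i := `|(k %% n)%Z|%N.
have ei : (i%:Z = k %% n)%Z by rewrite gez0_abs // modz_ge0 // -lt0n.
exists (a + e *+ i).
  apply/allpairsP; exists (a, i); split=> //=.
  by rewrite mem_iota add0n -ltz_nat ei ltz_pmod.
rewrite opprD addrA; apply: (zsub_trans sB (y := e *~ k)).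
  by rewrite addrAC.
rewrite pmulrn ei {1}(divz_eq k n) mulrzDr addrK mulrC mulrzA -pmulrn.
exact: (zsubMz sB).
Qed.

End FiniteSpan.

(** * Subgroups and quotients of groups *)

(** Groups of the statement become [groupType]s with classical equality and choice; the usual
    notations unfold to the original operations. *)
HB.instance Definition _ (G : Defs.group) := gen_eqMixin (carrier G).
HB.instance Definition _ (G : Defs.group) := gen_choiceMixin (carrier G).
HB.instance Definition _ (G : Defs.group) :=
  isGroup.Build (carrier G) (@Defs.mulA G) (@Defs.mul1g G) (@Defs.mulg1 G)
    (@Defs.mulVg G) (@Defs.mulgV G).

Local Close Scope ring_scope.
Local Open Scope group_scope.

Section CommutatorIdentities.
Variable T : groupType.
Implicit Types x y z : T.

Lemma commgM_conj x y z : [~ x, y * z] = [~ x, z] * [~ x, y] ^ z.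
Proof. by rewrite !commgEl !conjgE invgM !mulgA !mulgK. Qed.

Lemma commMg_conj x y z : [~ x * y, z] = [~ x, z] ^ y * [~ y, z].
Proof. by rewrite -invgR commgM_conj invgM -conjVg !invgR. Qed.

Lemma mul_conj_comm x y z : x^-1 * (y * x ^ z) = y ^ x * [~ x, z].
Proof. by rewrite commgEl [y ^ x]conjgE; move: (x ^ z) => w;
  rewrite -!mulgA mulVKg. Qed.

End CommutatorIdentities.

Section Subgroups.
Variable G : Defs.group.
Implicit Types (H N S : G -> Prop) (x y : G).

Section Closure.
Variables (H : G -> Prop) (sH : Defs.subgroup G H).
Lemma subgroup1 : H 1. Proof. by case: sH. Qed.
Lemma subgroupM x y : H x -> H y -> H (x * y). Proof. by case: sH => _ [h _];
  apply: h. Qed.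
Lemma subgroupV x : H x -> H x^-1. Proof. by case: sH => _ [_]; apply. Qed.
Lemma subgroupR x y : H x -> H y -> H [~ x, y].
Proof. by move=> Hx Hy; do !apply: subgroupM => //; apply: subgroupV. Qed.
End Closure.

Lemma subgroup_gen S : Defs.subgroup G (gen G S).
Proof.
split=> [H sH _|]; first exact: (subgroup1 sH).
split=> [x y hx hy|x hx] H sH SH.
  by apply: (subgroupM sH); [apply: hx|apply: hy].
by apply: (subgroupV sH); apply: hx.
Qed.

Lemma gen_in S x : S x -> gen G S x.
Proof. by move=> Sx H _; apply. Qed.

Lemma normal_subgroup N : Defs.normal G N -> Defs.subgroup G N.
Proof. by case. Qed.

Lemma normalJ N x y : Defs.normal G N -> N x -> N (x ^ y).
Proof. by case=> _; apply. Qed.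

Lemma normalR N x y : Defs.normal G N -> N x -> N [~ x, y].
Proof.
by move=> nN Nx; apply: (subgroupM (proj1 nN));
  [apply: (subgroupV (proj1 nN))|apply: normalJ].
Qed.

Lemma normalRr N x y : Defs.normal G N -> N y -> N [~ x, y].
Proof.
move=> nN Ny; rewrite -invgR; apply: (subgroupV (proj1 nN)); exact: normalR.
Qed.

Lemma subgroup_conj H y : Defs.subgroup G H -> Defs.subgroup G (fun x => H (x ^ y)).
Proof.
move=> sH; split; first by rewrite -[Defs.one G]/(1%g : G) conj1g; apply: subgroup1.
split=> [x z|x] /=.
  by move=> hx hz; rewrite -[Defs.mul G x z]/(x * z) conjMg; apply: subgroupM.
by move=> hx; rewrite -[Defs.inv G x]/(x^-1) conjVg; apply: subgroupV.
Qed.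

Lemma normal_gen S : (forall x y, S x -> S (x ^ y)) -> Defs.normal G (gen G S).
Proof.
move=> SJ; split=> [|x y hx]; first exact: subgroup_gen.
apply: (hx (fun x => gen G S (x ^ y))); first exact/subgroup_conj/subgroup_gen.
by move=> z Sz; apply: gen_in; apply: SJ.
Qed.

Lemma subgroup_lcs N n : Defs.subgroup G N -> Defs.subgroup G (lcs G N n).
Proof. by case: n => //= n _; apply: subgroup_gen. Qed.

Lemma normal_lcs N n : Defs.normal G N -> Defs.normal G (lcs G N n).
Proof.
move=> nN; elim: n => //= n IH; apply: normal_gen => _ y [a [b [La [Nb ->]]]].
exists (a ^ y), (b ^ y); split; [exact: normalJ|split; [exact: normalJ|]].
by rewrite -[Defs.commg G a b]/([~ a, b]) conjRg.
Qed.

Lemma lcs_comm N n a b : lcs G N n a -> N b -> lcs G N n.+1 [~ a, b].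
Proof. by move=> La Nb; apply: gen_in; exists a, b. Qed.

Lemma lcs_sub N n x : Defs.normal G N -> lcs G N n.+1 x -> lcs G N n x.
Proof.
move=> nN; apply; first exact/subgroup_lcs/normal_subgroup.
by move=> _ [a [b [La [Nb ->]]]]; apply: normalR => //; apply: normal_lcs.
Qed.

End Subgroups.

(** * Quotients carried by canonical coset representatives *)

Section CosetRepresentatives.
Variables (G : Defs.group) (K : G -> Prop) (sK : Defs.subgroup G K).

(** [choose] depends only on the extension of the predicate, so elements of one coset [x K] get the
    same representative. *)
Definition coset_repr (x : G) : G := choose (fun y => `[< K (x^-1 * y) >]) x.

Lemma coset_reprP x : K (x^-1 * coset_repr x).
Proof.
apply/asboolP; apply: (@chooseP _ (fun y => `[< K (x^-1 * y) >])).
by apply/asboolP; rewrite mulVg; apply: subgroup1.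
Qed.

Lemma coset_repr_eq x y : coset_repr x = coset_repr y <-> K (x^-1 * y).
Proof.
have Kx z : `[< K (z^-1 * z) >] by apply/asboolP; rewrite mulVg; apply: subgroup1.
split=> [e|Kxy].
  have := subgroupM sK (coset_reprP x) (subgroupV sK (coset_reprP y)).
  by rewrite e invgM invgK mulgA mulgK.
rewrite /coset_repr.
have eK : (fun u => `[< K (x^-1 * u) >]) =1 (fun u => `[< K (y^-1 * u) >]).
  move=> u; apply: asbool_equiv_eq; split=> h.
    have -> : y^-1 * u = (x^-1 * y)^-1 * (x^-1 * u) by rewrite invgM invgK -mulgA mulKVg.
    exact: (subgroupM sK (subgroupV sK Kxy)).
  have -> : x^-1 * u = (x^-1 * y) * (y^-1 * u) by rewrite -mulgA mulKVg.
  exact: (subgroupM sK Kxy).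
rewrite (eq_choose eK); apply: choose_id => //.
by rewrite -eK; apply/asboolP; rewrite mulVg; apply: subgroup1.
Qed.

Lemma coset_repr_id x : coset_repr (coset_repr x) = coset_repr x.
Proof. by apply/esym/coset_repr_eq/coset_reprP. Qed.

End CosetRepresentatives.

Lemma abelian_quotient (G : Defs.group) (N K : G -> Prop) :
  Defs.subgroup G N -> Defs.subgroup G K -> (forall x, K x -> N x) ->
  (forall x y, K x -> N y -> K (x ^ y)) ->
  (forall x y, N x -> N y -> K [~ x, y]) ->
  exists (M : zmodType) (f : G -> M),
    [/\ forall x y, N x -> N y -> f (x * y) = (f x + f y)%R,
        forall m, exists2 x, N x & f x = m &
        forall x, N x -> (f x = 0%R <-> K x)].
Proof.
move=> sN sK KN KJ KR; pose r := coset_repr K.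
have Nr x : N x -> N (r x).
  by move=> Nx; rewrite -(mulVKg x (r x)); apply: (subgroupM sN) => //; apply: KN;
    apply: (coset_reprP sK).
pose P x := `[< N x >] && (r x == x).
have Pr x : N x -> P (r x).
  by move=> Nx; apply/andP; split; [apply/asboolP;
    apply: Nr|rewrite /r (coset_repr_id sK)].
pose Q := {x : G | P x}.
(* [f] is total on [G]; the default outside [N] is the class of [1]. *)
pose f x : Q := insubd (Sub (r 1) (Pr 1 (subgroup1 sN)) : Q) (r x).
have val_f x : N x -> val (f x) = r x by move=> /Pr h; rewrite val_insubd h.
have Nval (a : Q) : N (val a) by case/andP: (valP a) => /asboolP.
have f_val (a : Q) : f (val a) = a.
  by apply: val_inj; rewrite val_f //; case/andP: (valP a) => _ /eqP.
have f_eq x y : N x -> N y -> (f x = f y <-> K (x^-1 * y)).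
  move=> Nx Ny; rewrite -(coset_repr_eq sK) -/r -!val_f //.
  by split=> [->//|/val_inj].
pose add (a b : Q) := f (val a * val b).
pose opp (a : Q) := f (val a)^-1.
have valK x : N x -> K (x^-1 * val (f x)).
  by move=> Nx; rewrite val_f //; apply: (coset_reprP sK).
have fM x y : N x -> N y -> f (x * y) = add (f x) (f y).
  move=> Nx Ny; apply/f_eq; [exact: (subgroupM sN)|exact: (subgroupM sN)|].
  have -> : (x * y)^-1 * (val (f x) * val (f y)) =
     (x^-1 * val (f x)) ^ y * (y^-1 * val (f y)).
    by rewrite conjgE invgM !mulgA mulgK.
  by apply: (subgroupM sK); [apply: KJ => //; apply: valK|apply: valK].
have addE a b : add a b = f (val a * val b) by [].
have addA : associative add.
  move=> a b c; rewrite -[a]f_val -[b]f_val -[c]f_val -!fM ?mulgA //;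
    exact: (subgroupM sN).
have addC : commutative add.
  move=> a b; apply/f_eq; [exact: (subgroupM sN)|exact: (subgroupM sN)|].
  by rewrite invgM -mulgA; apply: KR.
have add0 : left_id (f 1) add.
  by move=> a; rewrite -[a]f_val -fM ?mul1g //; apply: subgroup1.
have addN : left_inverse (f 1) opp add.
  by move=> a; rewrite -{2}[a]f_val /opp -fM ?mulVg //; apply: subgroupV.
pose M : zmodType := HB.pack Q (GRing.isZmodule.Build Q addA addC add0 addN).
exists M, f; split=> [x y Nx Ny|m|x Nx]; [exact: fM|by exists (val m)|].
rewrite -[0%R]/(f 1); split=> [e|Kx].
  by have /f_eq := esym e; rewrite invg1 mul1g; apply=> //; apply: subgroup1.
by apply/f_eq => //; [apply: subgroup1|rewrite mulg1; apply: subgroupV].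
Qed.

Lemma finite_quotient (G : Defs.group) (K : G -> Prop) :
  Defs.normal G K -> finite_index G K ->
  exists (F : finGroupType) (f : G -> F),
    [/\ {morph f : x y / x * y}, forall a, exists x, f x = a &
        forall x, f x = 1 <-> K x].
Proof.
move=> nK [l hl]; have sK := proj1 nK; pose r := coset_repr K.
pose s := map r l.
have rs x : r x \in s.
  have [a [la Kax]] := hl x; apply/mapP; exists a.
    by elim: (l) la => //= b l' IH [->|/IH]; rewrite inE ?eqxx // => ->; rewrite orbT.
  by apply: esym; apply/(coset_repr_eq sK).
pose Q := seq_sub s; pose f x : Q := SeqSub (rs x).
have f_val (a : Q) : f (val a) = a.
  by apply: val_inj => /=; case: a => x /= /mapP[y _ ->]; apply: (coset_repr_id sK).
have f_eq x y : f x = f y <-> K (x^-1 * y).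
  rewrite -(coset_repr_eq sK); split=> [/(congr1 val)//|e].
  by apply: val_inj; apply: e.
pose mul (a b : Q) := f (val a * val b).
have valK x : K (x^-1 * val (f x)) by apply: (coset_reprP sK).
have fM x y : f (x * y) = mul (f x) (f y).
  apply/f_eq; have -> : (x * y)^-1 * (val (f x) * val (f y)) =
     (x^-1 * val (f x)) ^ y * (y^-1 * val (f y)).
    by rewrite conjgE invgM !mulgA mulgK.
  by apply: (subgroupM sK); [apply: (normalJ _ nK)|].
have mulA : associative mul.
  by move=> a b c; rewrite -[a]f_val -[b]f_val -[c]f_val -!fM mulgA.
have mul1 : left_id (f 1) mul.
  by move=> a; rewrite -[a]f_val -fM mul1g.
have mulV : left_inverse (f 1) (fun a : Q => f (val a)^-1) mul.
  by move=> a; rewrite -{2}[a]f_val -fM mulVg.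
pose F : finGroupType := HB.pack Q (Finite_isGroup.Build Q mulA mul1 mulV).
exists F, f; split=> [x y|a|x]; [exact: fM|by exists (val a); apply: f_val|].
rewrite -[1]/(f 1); split=> [e|Kx].
  by have /f_eq := esym e; rewrite invg1 mul1g.
by apply/f_eq; rewrite mulg1; apply: subgroupV.
Qed.

(** * Hall's nilpotency criterion *)

Section Hall.
Variable G : Defs.group.

(** The left-normed commutator [[U, G, ..., G]] with [i] copies of [G]. *)
Fixpoint comm_iter (U : G -> Prop) i : G -> Prop :=
  if i is i'.+1 then gen G (fun y => exists a g, comm_iter U i' a /\ y = [~ a, g]) else U.

Lemma normal_comm_iter U i : Defs.normal G U -> Defs.normal G (comm_iter U i).
Proof.
move=> nU; elim: i => //= i IH; apply: normal_gen => _ y [a [g [Ua ->]]].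
by exists (a ^ y), (g ^ y); split; [apply: normalJ|rewrite conjRg].
Qed.

Lemma comm_iter_comm U i a g : comm_iter U i a -> comm_iter U i.+1 [~ a, g].
Proof. by move=> Ua; apply: gen_in; exists a, g. Qed.

Lemma comm_iter_leq U i j x : Defs.normal G U -> (i <= j)%N ->
  comm_iter U j x -> comm_iter U i x.
Proof.
move=> nU /subnK <-; elim: (j - i)%N x => //= k IH x hx; apply: hx.
  exact: (proj1 (normal_comm_iter i nU)).
by move=> _ [a [g [/IH Ua ->]]]; apply: normalR => //; apply: normal_comm_iter.
Qed.

Lemma lcs_comm_iter (U : G -> Prop) d : (forall x, lcs G (fun _ => True) d x -> U x) ->
  forall i x, lcs G (fun _ => True) (i + d) x -> comm_iter U i x.
Proof.
move=> hd; elim=> //= i IH x; apply; first exact: subgroup_gen.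
by move=> _ [a [b [/IH Ua [_ ->]]]]; apply: comm_iter_comm.
Qed.

Lemma subgroup_central_mod (W : G -> Prop) : Defs.normal G W ->
  Defs.subgroup G (fun w => forall g, W [~ w, g]).
Proof.
move=> nW; have sW := proj1 nW; split=> [g|].
  by rewrite -[Defs.one G]/(1%g : G) comm1g; apply: (subgroup1 sW).
split=> [x y hx hy g|x hx g].
  rewrite -[Defs.mul G x y]/(x * y) commMg_conj.
  by apply: (subgroupM sW) => //; apply: normalJ.
rewrite -[Defs.inv G x]/(x^-1).
have -> : [~ x^-1, g] = ([~ x, g] ^ x^-1)^-1.
  by apply: (mulgI ([~ x, g] ^ x^-1)); rewrite mulgV -commMg_conj mulgV comm1g.
by apply: (subgroupV sW); apply: normalJ.
Qed.

Variable N : G -> Prop.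
Hypothesis nN : Defs.normal G N.
Let L := lcs G N.
Let nL n : Defs.normal G (L n) := normal_lcs n nN.

Lemma lcs_subN n x : L n x -> N x.
Proof. by elim: n x => // n IH x /(lcs_sub nN)/IH. Qed.

(* Modulo [L n.+2] the map [v |-> [u, v]] is a morphism into a central
   subgroup, so it kills [L 1]. *)
Lemma lcs_comm_derived n u v : L n u -> L 1 v -> L n.+2 [~ u, v].
Proof.
move=> Lu Lv; have sL := proj1 (nL n.+2); apply: (Lv (fun v => L n.+2 [~ u, v])).
  split; first by rewrite -[Defs.one G]/(1%g : G) commg1; apply: (subgroup1 sL).
  split=> [x y hx hy|x hx].
    rewrite -[Defs.mul G x y]/(x * y) commgM_conj.
    by apply: (subgroupM sL) => //; apply: (normalJ _ (nL n.+2)).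
  rewrite -[Defs.inv G x]/(x^-1).
  have -> : [~ u, x^-1] = ([~ u, x] ^ x^-1)^-1.
    by apply: (mulIg ([~ u, x] ^ x^-1)); rewrite mulVg -commgM_conj mulgV commg1.
  by apply: (subgroupV sL); apply: (normalJ _ (nL n.+2)).
move=> _ [a [b [Na [Nb ->]]]]; rewrite -[Defs.commg G a b]/([~ a, b]).
have La : L n.+1 [~ u, a] by apply: lcs_comm.
have Lb : L n.+1 [~ u, b] by apply: lcs_comm.
set r := [~ a, b]; have Nr : N r by apply: (subgroupR (proj1 nN)).
(* Since [a * b = b * a * r], [[~ u, r]] compares [[~ u, a * b]] with a conjugate of [[~ u, b * a]];
   modulo [L n.+2] both equal [[~ u, a] * [~ u, b]]. *)
have e : [~ u, a * b] = [~ u, r] * [~ u, b * a] ^ r by rewrite commgC commgM_conj.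
have -> : [~ u, r] = [~ u, a * b] * ([~ u, b * a] ^ r)^-1 by rewrite e mulgK.
rewrite !commgM_conj; set p := [~ u, a] in La *; set q := [~ u, b] in Lb *.
have -> : p ^ b = p * [~ p, b] by rewrite commgEl mulVKg.
have -> : q ^ a = q * [~ q, a] by rewrite commgEl mulVKg.
have Lpb : L n.+2 [~ p, b] by apply: lcs_comm.
have Lqa : L n.+2 [~ q, a] by apply: lcs_comm.
have Lpq : L n.+2 [~ q, p].
  by apply: lcs_comm => //; apply: lcs_subN La.
have -> : (p * (q * [~ q, a])) ^ r = p * q * [~ p * q, r] * [~ q, a] ^ r.
  by rewrite mulgA conjMg [[~ p * q, r]]commgEl mulVKg.
have Lpqr : L n.+2 [~ p * q, r] by apply: lcs_comm => //;
  apply: (subgroupM (proj1 (nL n.+1))).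
have -> : q * (p * [~ p, b]) = p * q * ([~ q, p] * [~ p, b]) by rewrite mulgA [q * p]commgC -!mulgA.
set s := p * q; rewrite -[s * [~ s, r] * _]mulgA invgM.
set m1 := _ * [~ p, b]; set m2 := [~ s, r] * _.
have -> : s * m1 * (m2^-1 * s^-1) = (m1 * m2^-1) ^ s^-1 by rewrite conjgE invgK !mulgA.
apply: (normalJ _ (nL n.+2)); apply: (subgroupM sL); first exact: (subgroupM sL).
by apply: (subgroupV sL); apply: (subgroupM sL) => //; apply: (normalJ _ (nL n.+2)).
Qed.

(** [L n.+1] is generated by commutators [[~ u, v]], and a Leibniz rule distributes further
    commutations with [G] over [u] and [v]; [W m] records, modulo [L n.+2], that at least [m] of
    them have occurred. After [r + s], either [u] lies in [L n.+1] or [v] in [L 1]. *)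
Lemma comm_iter_lcs s : (forall x, comm_iter N s x -> L 1 x) ->
  forall n, exists r, forall x, comm_iter (L n) r x -> L n.+1 x.
Proof.
move=> hs; elim=> [|n [r hr]]; first by exists s.
pose S m y := L n.+2 y \/ exists i j u v,
  [/\ (m <= i + j)%N, comm_iter (L n) i u, comm_iter N j v & y = [~ u, v]].
pose W m := gen G (S m).
have nU i := normal_comm_iter i (nL n); have nV j := normal_comm_iter j nN.
have nW m : Defs.normal G (W m).
  apply: normal_gen => x y [Lx|[i [j [u [v [le Uu Vv ->]]]]]].
    by left; apply: (normalJ _ (nL n.+2)).
  right; exists i, j, (u ^ y), (v ^ y).
  by split=> //; [apply: (normalJ _ (nU i))|apply: (normalJ _ (nV j))|rewrite conjRg].
have Wcomm m w g : W m w -> W m.+1 [~ w, g].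
  move=> Ww; move: g; have sW := proj1 (nW m.+1).
  apply: (Ww (fun w => forall g, W m.+1 [~ w, g])); first exact: subgroup_central_mod.
  move=> y [Ly g|[i [j [u [v [le Uu Vv ->]]]]] g].
    by apply: gen_in; left; apply: (normalR _ (nL n.+2)).
  pose a := [~ u, g]; pose b := [~ v, g]; pose c := [~ u, v].
  have Ua : comm_iter (L n) i.+1 a by apply: comm_iter_comm.
  have Vb : comm_iter N j.+1 b by apply: comm_iter_comm.
  have Lu : L n u by apply: (comm_iter_leq (nL n) (leq0n i) Uu).
  have La : L n a by apply: (comm_iter_leq (nL n) (leq0n i.+1) Ua).
  have Nv : N v by apply: (comm_iter_leq nN (leq0n j) Vv).
  have Nb : N b by apply: (comm_iter_leq nN (leq0n j.+1) Vb).
  have Nba : N (b * a) by apply: (subgroupM (proj1 nN)) => //; apply: lcs_subN La.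
  (* Expansion of [c ^ g = [~ u * a, v * b]]: the outer factors raise [j] and [i] respectively by
     one, and the middle factor lies in [L n.+2]. *)
  have -> : [~ c, g] = ([~ u, b] ^ a) ^ c * ([~ c, b * a] * [~ a, v ^ g]).
    rewrite [[~ c, g]]commgEl /c conjRg -/c.
    have -> : u ^ g = u * a by rewrite /a commgEl mulVKg.
    rewrite commMg_conj [LHS]mulgA [RHS]mulgA; congr (_ * _).
    have -> : v ^ g = v * b by rewrite /b commgEl mulVKg.
    by rewrite commgM_conj conjMg -conjgM; apply: mul_conj_comm.
  apply: (subgroupM sW); [|apply: (subgroupM sW)].
  - do 2!apply: (normalJ _ (nW m.+1)); apply: gen_in; right; exists i, j.+1, u, b.
    by rewrite addnS ltnS.
  - by apply: gen_in; left; apply: lcs_comm => //; apply: lcs_comm.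
  - apply: gen_in; right; exists i.+1, j, a, (v ^ g).
    by rewrite addSn ltnS; split=> //; apply: (normalJ _ (nV j)).
have iterW k x : comm_iter (L n.+1) k x -> W k x.
  elim: k x => [|k IH] x.
    apply; first exact: (proj1 (nW 0)).
    by move=> _ [u [v [Lu [Nv ->]]]]; apply: gen_in; right; exists 0%N, 0%N, u, v.
  apply; first exact: (proj1 (nW k.+1)).
  by move=> _ [a [g [/IH Wa ->]]]; apply: Wcomm.
exists (r + s)%N => x /iterW; apply; first exact: (proj1 (nL n.+2)).
move=> y [//|[i [j [u [v [le Uu Vv ->]]]]]].
have [ri|ir] := leqP r i.
  apply: lcs_comm; first by apply: hr; apply: comm_iter_leq Uu.
  exact: (comm_iter_leq nN (leq0n j) Vv).
apply: lcs_comm_derived; first exact: (comm_iter_leq (nL n) (leq0n i) Uu).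
apply: hs; apply: comm_iter_leq Vv => //.
by rewrite -(leq_add2l r); apply: leq_trans le _; rewrite leq_add2r ltnW.
Qed.

Lemma Hall_nilpotent c : (forall x, lcs G (fun _ => True) c x -> L 1 x) ->
  Defs.nilpotent G N -> nilpotent_group G.
Proof.
move=> hc [k hk].
have hs x : comm_iter N c x -> L 1 x.
  move=> Vx; apply: hc; elim: (c) x Vx => [//|d IH] x.
  apply; first exact: subgroup_gen.
  by move=> _ [a [g [/IH La ->]]]; apply: lcs_comm.
suff [d hd] : exists d, forall x, lcs G (fun _ => True) d x -> L k x.
  by exists d => x /hd/hk.
elim: k {hk} => [|n [d hd]]; first by exists c => x /hc Lx;
  apply: (@lcs_sub G N 0 x nN Lx).
have [r hr] := comm_iter_lcs hs n; exists (r + d)%N => x.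
by move/(lcs_comm_iter hd)/hr.
Qed.

End Hall.

(** * Groups without proper contranormal subgroups *)

(** A proper normaliser of a Sylow subgroup [P] would lie in a normal maximal [H], and Frattini
    would give [G = H 'N(P) = H]. So all Sylow subgroups are normal and lie in the Fitting
    subgroup. *)
Lemma maximal_normal_nilpotent (gT : finGroupType) (G : {group gT}) :
  (forall H : {group gT}, maximal H G -> H <| G) -> nilpotent G.
Proof.
move=> maxn; suff sGF : G \subset 'F(G) by apply: nilpotentS sGF (Fitting_nil G).
rewrite -{1}(Sylow_gen G) gen_subG; apply/bigcupsP => P /SylowP[p pr_p sylP].
apply: Fitting_max; last exact: pgroup_nil (pHall_pgroup sylP).
rewrite /normal (pHall_sub sylP) /=.
have [eN|[H maxH sNH]] := maximal_exists (subsetIl G 'N(P)).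
  by apply/setIidPl.
have nHG := maxn H maxH; have sHG := normal_sub nHG.
have sPH : P \subset H.
  by apply: subset_trans sNH; rewrite subsetI (pHall_sub sylP) normG.
have := Frattini_arg nHG (pHall_subl sPH sHG sylP).
rewrite (mulGSid sNH) => eHG; have := maxgroupp maxH.
by rewrite properE eHG subxx andbF.
Qed.

Section NoProperContranormal.
Variable G : Defs.group.
Hypothesis no_contranormal : forall H : G -> Prop,
  Defs.subgroup G H -> contranormal G H -> ~ Defs.proper G H.

Lemma contranormal_full (H : G -> Prop) : Defs.subgroup G H ->
  (forall R, Defs.normal G R -> (forall x, H x -> R x) -> forall x, R x) ->
  forall x, H x.
Proof.
move=> sH full x; apply: contrapT => nHx.
apply: (no_contranormal sH); last by exists x.
apply: (full (normal_closure G H)).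
  apply: normal_gen => _ y [h [z [Hh ->]]]; exists h, (z * y); split=> //.
  by rewrite -[Defs.conjg G h z]/(h ^ z) -conjgM.
move=> h Hh; apply: gen_in; exists h, 1; split=> //.
by rewrite -[Defs.conjg G h _]/(h ^ 1) conjg1.
Qed.

(** A non-normal maximal subgroup [H] of the finite quotient has contranormal preimage: a proper
    normal subgroup above it would have image exactly [H]. *)
Lemma lcs_finite_index (K : G -> Prop) : Defs.normal G K -> finite_index G K ->
  exists c, forall x, lcs G (fun _ => True) c x -> K x.
Proof.
move=> nK fK; have [F [f [fM fS fK1]]] := finite_quotient nK fK.
have f1 : f 1 = 1 by apply/fK1; case: nK => sK _; apply: subgroup1.
have fV x : f x^-1 = (f x)^-1 by apply: (mulgI (f x)); rewrite -fM !mulgV.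
have fJ x y : f (x ^ y) = f x ^ f y by rewrite !conjgE !fM fV.
have /lcnP[c Lc] : nilpotent [set: F].
  apply: maximal_normal_nilpotent => H maxH; apply: contrapT => nH.
  have sH : Defs.subgroup G (fun x => f x \in H).
    split; first by rewrite -[Defs.one G]/(1%g : G) f1.
    split=> [x y hx hy|x hx].
      by rewrite -[Defs.mul G x y]/(x * y) fM groupM.
    by rewrite -[Defs.inv G x]/(x^-1) fV groupV.
  have full x : f x \in H.
    move: x; apply: (contranormal_full sH) => R nR HR; apply: contrapT => nRall.
    pose fR := [set a | `[< exists2 x, R x & f x = a >]].
    have gR : group_set fR.
      apply/group_setP; split; first by rewrite inE; apply/asboolP; exists 1 => //;
        apply: (subgroup1 (proj1 nR)).
      move=> a b; rewrite !inE => /asboolP[x Rx <-] /asboolP[y Ry <-].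
      by apply/asboolP; exists (x * y); rewrite ?fM //; apply: (subgroupM (proj1 nR)).
    have sHR : H \subset fR.
      apply/subsetP => a Ha; have [x ex] := fS a; rewrite inE; apply/asboolP;
        exists x => //.
      by apply: HR; rewrite ex.
    have KR x : K x -> R x by move/fK1=> ex; apply: HR; rewrite ex.
    have fRP x : (f x \in fR) -> R x.
      rewrite inE => /asboolP[y Ry e]; rewrite -(mulVKg y x).
      apply: (subgroupM (proj1 nR)) => //; apply/KR/fK1.
      by rewrite fM fV e mulVg.
    case/maxgroupP: (maxH) => _ maxi.
    have [prop|] := boolP (Group gR \proper [set: F]); last first.
      by rewrite properE subsetT /= negbK => /subsetP sT; apply: nRall => x;
        apply/fRP/sT.
    have eR := maxi (Group gR) prop sHR; apply: nH.
    rewrite /normal subsetT /=; apply/subsetP => a _; rewrite inE;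
      apply/subsetP => _ /imsetP[b Hb ->].
    have [x ex] := fS a; have [y ey] := fS b.
    rewrite -ex -ey -fJ -eR inE; apply/asboolP; exists (y ^ x) => //.
    by apply: normalJ => //; apply: HR; rewrite ey.
  have := maxgroupp maxH; rewrite properE => /andP[_ /negP]; apply.
  by apply/subsetP => a _; have [x <-] := fS a.
exists c => x Lx; apply/fK1/set1gP; rewrite -Lc.
elim: c {Lc} x Lx => [|c IH] x; first by rewrite lcn1 inE.
(* [lcs] counts from [0] but ['L_] from [1], so [lcs] at [c.+1] matches ['L_c.+2]. *)
move=> Lx; apply: (Lx (fun x => f x \in 'L_c.+2([set: F]))).
  split; first by rewrite -[Defs.one G]/(1%g : G) f1.
  split=> [y z hy hz|y hy].
    by rewrite -[Defs.mul G y z]/(y * z) fM groupM.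
  by rewrite -[Defs.inv G y]/(y^-1) fV groupV.
move=> _ [a [b [La [_ ->]]]]; rewrite -[Defs.commg G a b]/([~ a, b]).
rewrite /commg fM fV fJ lcnSn; apply: mem_commg; [exact: IH|exact: in_setT].
Qed.

Lemma finite_index_exp (K : G -> Prop) z : Defs.normal G K -> finite_index G K ->
  exists2 n, (0 < n)%N & K (z ^+ n).
Proof.
move=> nK fK; have [F [f [fM fS fK1]]] := finite_quotient nK fK.
have f1 : f 1 = 1 by apply/fK1; case: nK => sK _; apply: subgroup1.
exists #[f z]; first exact: order_gt0.
apply/fK1; rewrite -(expg_order (f z)); elim: #[f z] => // n IH.
by rewrite !expgS fM IH.
Qed.

(** * The conjugation action on [N] modulo its derived subgroup *)

Section AbelianQuotient.
Variable N : G -> Prop.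
Hypotheses (nN : Defs.normal G N) (fiN : finite_index G N).
Let sN : Defs.subgroup G N := proj1 nN.
Let K := lcs G N 1.
Let nK : Defs.normal G K := normal_lcs 1 nN.
Let sK : Defs.subgroup G K := proj1 nK.
Let KR x y : N x -> N y -> K [~ x, y].
Proof. exact: (@lcs_comm G N 0). Qed.

Lemma left_transversal : exists l : seq G,
  1 \in l /\ forall g, exists2 t, t \in l & N (g * t^-1).
Proof.
have [l hl] := fiN; exists (1 :: l); split=> [|g]; first exact: mem_head.
have [a [la Na]] := hl g; exists a.
  rewrite inE; apply/orP; right.
  by elim: (l) la => //= b l' IH [->|/IH]; rewrite inE ?eqxx // => ->; rewrite orbT.
have := normalJ a^-1 nN Na.
by rewrite -[Defs.mul G _ g]/(a^-1 * g) conjgE invgK !mulgA mulgV mul1g.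
Qed.

Variables (M : zmodType) (f : G -> M) (act : G -> {additive M -> M}).
Hypothesis fM : forall x y, N x -> N y -> f (x * y) = (f x + f y)%R.
Hypothesis f_surj : forall m, exists2 x, N x & f x = m.
Hypothesis f_ker : forall x, N x -> (f x = 0%R <-> K x).
Hypothesis actE : forall g x, N x -> act g (f x) = f (x ^ g).

Let f1 : f 1 = 0%R.
Proof. by apply/f_ker; [apply: (subgroup1 sN)|apply: (subgroup1 sK)]. Qed.

Let fV x : N x -> f x^-1 = (- f x)%R.
Proof.
move=> Nx; apply: (@addrI _ (f x)); rewrite -fM ?mulgV ?f1 ?subrr //.
exact: (subgroupV sN).
Qed.

Let act1 m : act 1 m = m.
Proof. by have [x Nx <-] := f_surj m; rewrite actE // conjg1. Qed.

Let actM g h m : act (g * h) m = act h (act g m).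
Proof.
have [x Nx <-] := f_surj m; rewrite !actE ?conjgM //; exact: (normalJ g nN Nx).
Qed.

Let act_triv g : N g -> act g =1 id.
Proof.
move=> Ng m; have [x Nx <-] := f_surj m; have NR := subgroupR sN Nx Ng.
rewrite actE // -(mulVKg x (x ^ g)) -commgEl fM //.
by rewrite ((f_ker NR).2 (KR Nx Ng)) addr0.
Qed.

Let f_comm x g : N x -> f [~ x, g] = (act g (f x) - f x)%R.
Proof.
move=> Nx; have Nxg := normalJ g nN Nx; have Nx' := subgroupV sN Nx.
by rewrite commgEl (fM Nx' Nxg) fV // actE // addrC.
Qed.

Let act_cover (l : seq G) : (forall g, exists2 t, t \in l & N (g * t^-1)) ->
  forall g, exists2 t, t \in l & act g =1 act t.
Proof.
move=> hl g; have [t lt Nt] := hl g; exists t => // m.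
by rewrite -[g](mulgVK t) actM (act_triv Nt).
Qed.

Let preim (B : M -> Prop) x := N x /\ B (f x).

Let normal_preim B : zsubgroup B -> invariant act B -> Defs.normal G (preim B).
Proof.
move=> sB iB; split.
  split; first by split; [exact: (subgroup1 sN)|rewrite f1; exact: (zsub0 sB)].
  split=> [x y [Nx Bx] [Ny By]|x [Nx Bx]].
    by split; [exact: (subgroupM sN)|rewrite fM //; exact: (zsubD sB)].
  by split; [exact: (subgroupV sN)|rewrite fV //; exact: (zsubN sB)].
move=> x g [Nx Bx]; split; first exact: (normalJ g nN Nx).
by rewrite -actE //; apply: iB.
Qed.

Lemma abelian_no_perfect (B : M -> Prop) : zsubgroup B -> invariant act B ->
  (forall x, exists2 n, (0 < n)%N & B (x *+ n)%R) ->
  (forall C : M -> Prop, zsubgroup C -> (forall x, B x -> C x) ->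
     (forall g x, C (act g x - x)%R) -> forall x, C x) ->
  forall x, B x.
Proof.
move=> sB iB tB perf.
have [l [l1 hl]] := left_transversal; have act_l := act_cover hl.
have nB := normal_preim sB iB.
have KB x : K x -> preim B x.
  move=> Kx; have Nx : N x := @lcs_sub G N 0 x nN Kx.
  by split=> //; rewrite ((f_ker Nx).2 Kx); apply: (zsub0 sB).
suff fiB : finite_index G (preim B).
  have [c hc] := lcs_finite_index nB fiB.
  (* By perfectness and [f_comm], every class modulo [B] has a representative in [N] and in term [j]
     of the lower central series of [G]; at [j = c] it lies in [preim B]. *)
  pose C j m := exists y, [/\ lcs G (fun _ => True) j y, N y & B (m - f y)%R].
  have Call j m : C j m.
    elim: j m => [m|j IH].
      by have [x Nx <-] := f_surj m; exists x; split=> //; rewrite subrr;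
        apply: (zsub0 sB).
    have sL : Defs.subgroup G (lcs G (fun _ => True) j.+1) by apply: subgroup_gen.
    apply: perf.
    - split=> [|m m' [y [Ly Ny By]] [y' [Ly' Ny' By']]].
        exists 1; rewrite f1 subrr; split;
          [exact: (subgroup1 sL)|exact: (subgroup1 sN)|exact: (zsub0 sB)].
      exists (y * y'^-1); split; first by apply: (subgroupM sL) => //;
        apply: (subgroupV sL).
        by apply: (subgroupM sN) => //; apply: (subgroupV sN).
      rewrite fM ?fV //; [exact: (zsub_congB sB)|exact: (subgroupV sN)].
    - move=> m Bm; exists 1; rewrite f1 subr0.
      by split=> //; [exact: (subgroup1 sL)|exact: (subgroup1 sN)].
    - move=> g m; have [y [Ly Ny By]] := IH m; exists [~ y, g].
      split; [exact: lcs_comm|exact: normalR|].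
      by rewrite f_comm //; apply: (zsub_congB sB) => //; rewrite -raddfB; apply: iB.
  by move=> m; have [y [/hc[_ By] _]] := Call c m; move/(zsub_mem sB); apply.
have /choice[tau tauP] : forall g, exists t, t \in l /\ N (g * t^-1).
  by move=> g; have [t lt Nt] := hl g; exists t.
pose part g := f (g * (tau g)^-1).
(* The [N]-parts of products and inverses of listed elements. With [B], their translates span an
   invariant [V], which makes [H] below a subgroup supplementing [N]. *)
pose es := [seq part (a * b) | a <- l, b <- l] ++ [seq part a^-1 | a <- l].
pose s := [seq act h e | h <- l, e <- es].
have [lv hlv] := zspan_finite sB tB s.
pose V := zspan (fun u => B u \/ u \in s).
have sV : zsubgroup V by apply: zsubgroup_span.
have Ves e : e \in es -> V e.
  move=> ees; apply: zspan_gen; right; rewrite -[e]act1; exact: allpairs_f.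
have iV : invariant act V.
  move=> g v Vv; apply: (Vv (fun v => V (act g v))).
    by split=> [|x y]; rewrite ?raddf0 ?raddfB; [apply: (zsub0 sV)|apply: (zsubB sV)].
  move=> u [Bu|/allpairsP[[h e] /= [lh ees ->]]]; apply: zspan_gen.
    by left; apply: iB.
  right; rewrite -actM; have [h' lh' ->] := act_l (h * g); exact: allpairs_f.
pose H x := exists t, [/\ t \in l, N (x * t^-1) & V (f (x * t^-1))].
have HN x : N x -> V (f x) -> H x by move=> Nx Vx; exists 1; rewrite invg1 mulg1.
have Hl t : t \in l -> H t.
  by move=> lt; exists t; rewrite mulgV f1; split=> //;
    [exact: (subgroup1 sN)|exact: (zsub0 sV)].
have sH : Defs.subgroup G H.
  split; first exact: Hl.
  split=> [x y [t [lt Nv Vv]] [u [lu Nw Vw]]|x [t [lt Nv Vv]]].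
    rewrite -[Defs.mul G x y]/(x * y).
    set v := x * t^-1 in Nv Vv; set w := y * u^-1 in Nw Vw.
    have [ls Ne] := tauP (t * u); exists (tau (t * u)).
    have Nwt : N (w ^ t^-1) by apply: normalJ.
    have -> : x * y * (tau (t * u))^-1 = v * (w ^ t^-1) * (t * u * (tau (t * u))^-1).
      by rewrite /v /w conjgE invgK !mulgA !mulgVK.
    have Nvw : N (v * w ^ t^-1) by apply: (subgroupM sN).
    split=> //; first exact: (subgroupM sN).
    rewrite (fM Nvw Ne) (fM Nv Nwt) -actE //; apply: (zsubD sV); last first.
      by apply: Ves; rewrite mem_cat; apply/orP; left; apply: allpairs_f.
    by apply: (zsubD sV) => //; apply: iV.
  rewrite -[Defs.inv G x]/(x^-1); set v := x * t^-1 in Nv Vv.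
  have [ls Ne] := tauP t^-1; exists (tau t^-1).
  have Nv' : N v^-1 by apply: (subgroupV sN).
  have Nvt : N (v^-1 ^ t) by apply: normalJ.
  have -> : x^-1 * (tau t^-1)^-1 = v^-1 ^ t * (t^-1 * (tau t^-1)^-1).
    by rewrite /v conjgE invgM invgK !mulgA mulgK mulVg mul1g.
  split=> //; first exact: (subgroupM sN).
  rewrite (fM Nvt Ne) -actE // fV //; apply: (zsubD sV); first by apply: iV;
    apply: (zsubN sV).
  by apply: Ves; rewrite mem_cat; apply/orP; right; apply: map_f.
have Hall : forall x, H x.
  apply: (contranormal_full sH) => R nR HR; have sR := proj1 nR.
  have BR x : preim B x -> R x.
    by case=> Nx Bx; apply/HR/HN => //; apply: zspan_gen; left.
  have KRR x : K x -> R x by move/KB/BR.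
  pose C m := exists x, [/\ N x, R x & f x = m].
  have CR x : N x -> C (f x) -> R x.
    move=> Nx [y [Ny Ry e]]; rewrite -(mulVKg y x); apply: (subgroupM sR) => //;
      apply/KRR/f_ker.
      by apply: (subgroupM sN) => //; apply: (subgroupV sN).
    by rewrite fM ?fV ?e ?addNr //; apply: (subgroupV sN).
  have NR x : N x -> R x.
    move=> Nx; apply: CR => //; apply: perf.
    - split=> [|_ _ [y [Ny Ry <-]] [y' [Ny' Ry' <-]]].
        by exists 1; split=> //; [exact: (subgroup1 sN)|exact: (subgroup1 sR)].
      exists (y * y'^-1); rewrite fM ?fV //; last exact: (subgroupV sN).
      by split=> //; [apply: (subgroupM sN) => //;
        apply: (subgroupV sN)|apply: (subgroupM sR) => //; apply: (subgroupV sR)].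
    - by move=> m Bm; have [y Ny ey] := f_surj m; exists y; split=> //; apply: BR;
      split; rewrite ?ey.
    - move=> g m; have [y Ny <-] := f_surj m; exists [~ y, g]; split;
      last exact: f_comm.
        exact: normalR.
      (* Write [g = v * t]: [[~ y, t]] lies in [R] because [t] does, and [[~ y, v]] lies in [K],
         hence in [R]. *)
      have [t lt Nt] := hl g; rewrite -[g](mulgVK t); set v := g * t^-1 in Nt *.
      rewrite commgM_conj; apply: (subgroupM sR); first by apply: normalRr => //;
        apply/HR/Hl.
      by apply: (normalJ _ nR); apply: KRR; apply: KR.
  move=> g; have [t lt Nt] := hl g; rewrite -[g](mulgVK t).
  by apply: (subgroupM sR); [apply: NR|apply/HR/Hl].
have /choice[sec secP] : forall m, exists x, N x /\ f x = m.
  by move=> m; have [x Nx ex] := f_surj m; exists x.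
(* As [H] is all of [G], every [f (x * t^-1)] lies in [V], which is finite modulo [B]. *)
exists [seq sec a * t | a <- lv, t <- l] => x.
have [t [lt Nv /hlv[a la Ba]]] := Hall x; exists (sec a * t); split.
  have : sec a * t \in [seq sec a * t | a <- lv, t <- l] by apply: allpairs_f.
  elim: [seq _ | _ <- _, _ <- _] => //= b r IH; rewrite inE => /predU1P[->|/IH];
    by [left|right].
have [Na ea] := secP a; rewrite -[Defs.mul G _ x]/((sec a * t)^-1 * x).
have -> : (sec a * t)^-1 * x = ((sec a)^-1 * (x * t^-1)) ^ t.
  by rewrite conjgE invgM !mulgA mulgVK.
apply: (normalJ t nB); split; first by apply: (subgroupM sN) => //;
  apply: (subgroupV sN).
by rewrite fM ?fV ?ea 1?addrC //; apply: (subgroupV sN).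
Qed.

(** Commutation with [g] acts on [M] as [g - 1], so [f] sends term [i + c] of the lower central
    series into [I ^ i M], which vanishes for [i = k]. *)
Lemma abelian_lcs : exists c, forall x, lcs G (fun _ => True) c x -> K x.
Proof.
have [l [_ /act_cover hl]] := left_transversal.
have [c hc] := lcs_finite_index nN fiN.
have [|||||k hk] := augn_eq0 act1 actM (ex_intro _ l hl) abelian_no_perfect
    (L := lcs G (fun _ => True)) (c := c) => //.
- by move=> j g h Lg; apply: (normalJ h _ Lg); apply: normal_lcs.
- by move=> j z g Lz; apply: lcs_comm.
- by move=> g /hc; apply: act_triv.
- by move=> z; have [n n0 Nz] := finite_index_exp z nN fiN; exists n => //;
  apply: act_triv.
suff h i x : lcs G (fun _ => True) (i + c) x -> N x /\ augn act i (f x).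
  by exists (k + c)%N => x /h[Nx /hk]; apply: (f_ker Nx).1.
elim: i x => [|i IH] x; first by move/hc.
have sA := zsubgroup_augn act i.+1.
move=> Lx; apply: (Lx (fun x => N x /\ augn act i.+1 (f x))).
  split; first by split; [exact: (subgroup1 sN)|rewrite f1; exact: (zsub0 sA)].
  split=> [u v [Nu Au] [Nv Av]|u [Nu Au]].
    by split; [exact: (subgroupM sN)|rewrite fM //; exact: (zsubD sA)].
  by split; [exact: (subgroupV sN)|rewrite fV //; exact: (zsubN sA)].
move=> _ [a [b [/IH[Na Aa] [_ ->]]]]; rewrite -[Defs.commg G a b]/([~ a, b]).
by split; [exact: normalR|rewrite f_comm //; apply: aug_gen].
Qed.

End AbelianQuotient.

Lemma lcs_derived (N : G -> Prop) : Defs.normal G N -> finite_index G N ->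
  exists c, forall x, lcs G (fun _ => True) c x -> lcs G N 1 x.
Proof.
move=> nN fiN; have sN := proj1 nN; have nK := normal_lcs 1 nN; have sK := proj1 nK.
have [|||M [f [fM f_surj f_ker]]] := abelian_quotient sN sK (K := lcs G N 1).
- by move=> x; apply: (@lcs_sub G N 0).
- by move=> x y Kx _; apply: (normalJ _ nK).
- by move=> x y; apply: (@lcs_comm G N 0).
have fV x : N x -> f x^-1 = (- f x)%R.
  move=> Nx; apply: (@addrI _ (f x)); rewrite -fM //; last exact: (subgroupV sN).
  by rewrite mulgV subrr; apply/f_ker; [apply: (subgroup1 sN)|apply: (subgroup1 sK)].
have f_eq x y : N x -> N y -> (f x = f y <-> lcs G N 1 (x^-1 * y)).
  move=> Nx Ny; have Nx' := subgroupV sN Nx.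
  rewrite -f_ker ?fM ?fV //; last exact: (subgroupM sN).
  split=> [->|/eqP]; first by rewrite addNr.
  by rewrite addrC subr_eq0 => /eqP.
have /choice[sec secP] : forall m, exists x, N x /\ f x = m.
  by move=> m; have [x Nx ex] := f_surj m; exists x.
(* Conjugation is transported through a section; [a0E] shows independence of the section because the
   derived subgroup of [N] is normal in [G]. *)
pose a0 g m := f (sec m ^ g).
have a0E g x : N x -> a0 g (f x) = f (x ^ g).
  move=> Nx; have [Ns es] := secP (f x); apply/f_eq; [exact: normalJ|exact: normalJ|].
  by rewrite -conjVg -conjMg; apply: (normalJ _ nK); apply/f_eq.
have a0B g : zmod_morphism (a0 g).
  move=> m m'; have [Nx ex] := secP m; have [Ny ey] := secP m'.
  rewrite -ex -ey -fV // -fM //; last exact: (subgroupV sN).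
  rewrite !a0E //; last by apply: (subgroupM sN) => //; apply: (subgroupV sN).
  rewrite conjMg conjVg fM ?fV //; try exact: normalJ.
  by apply: (subgroupV sN); apply: normalJ.
pose act g : {additive M -> M} := HB.pack (a0 g) (GRing.isZmodMorphism.Build M M (a0 g) (a0B g)).
exact: (abelian_lcs nN fiN fM f_surj f_ker (act := act)).
Qed.

End NoProperContranormal.

Import Defs.

Theorem theoremA (G : group) :
  (exists N : G -> Prop, normal G N /\ nilpotent G N /\ finite_index G N) ->
  (forall H : G -> Prop, subgroup G H -> contranormal G H -> ~ proper G H) ->
  nilpotent_group G.
Proof.
move=> [N [nN [nilN fiN]]] no_contranormal.
have [c hc] := lcs_derived no_contranormal nN fiN.
exact (Hall_nilpotent nN hc nilN).
Qed.
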